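(* There is an arithmetic term $M(a,b,p,q,n)$ with the following property. Let $a,b,p,q\in\mathbb{N}$ with $b,q\ge 1$, $a\le b$ and $p\le 4q$, and let $x(n)$ be the Logistic Map sequence $x(n+1)=r\,x(n)(1-x(n))$ with $x(0)=a/b\in[0,1]$ and $r=p/q\in[0,4]$. Let $a(n)$, $b(n)$ be the sequences of natural numbers defined by $a(0)=a$, $b(0)=b$, $a(n+1)=p\,a(n)(b(n)-a(n))$, $b(n+1)=q\,b(n)^2$. Then for all $n\in\mathbb{N}$, $$b(n)=q^{2^n-1}b^{2^n},\qquad a(n)=\left\lfloor \frac{M(a,b,p,q,n)}{\left(q^{2^n-1}b^{2^n}+1\right)^n}\right\rfloor,\qquad x(n)=\frac{a(n)}{b(n)},$$ where the last division is division of rational numbers.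
   Context: $\mathbb{N}=\{0,1,2,\dots\}$. An arithmetic term is a finite expression built from variables ranging over $\mathbb{N}$ and natural-number constants by composing addition $x+y$, truncated subtraction $x \dot{-} y=\max(x-y,0)$, multiplication, $\lfloor x/y\rfloor$, $x \bmod y$, and exponentiation $x^y$ (conventions: $x \bmod 0 = x$; for definiteness $\lfloor x/0\rfloor=0$, $0^0=1$). *)

(* Defs.v *)
From mathcomp Require Import all_boot all_order all_algebra.

Set Implicit Arguments.
Unset Strict Implicit.
Unset Printing Implicit Defensive.

(* Arithmetic terms in the variables x_0, ..., x_(k-1) ranging over nat. *)
Inductive aterm (k : nat) : Type :=
| aVar of 'I_k
| aConst of nat
| aAdd of aterm k & aterm k
| aMonus of aterm k & aterm k
| aMul of aterm k & aterm k
| aDiv of aterm k & aterm k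
| aMod of aterm k & aterm k
| aExp of aterm k & aterm k.

(* The operations of ssrnat and div follow the required conventions:
   m - n is truncated, m %/ 0 = 0, m %% 0 = m and 0 ^ 0 = 1. *)
Fixpoint aeval (k : nat) (t : aterm k) (v : k.-tuple nat) : nat :=
  match t with
  | aVar i => tnth v i
  | aConst c => c
  | aAdd t1 t2 => aeval t1 v + aeval t2 v
  | aMonus t1 t2 => aeval t1 v - aeval t2 v
  | aMul t1 t2 => aeval t1 v * aeval t2 v
  | aDiv t1 t2 => aeval t1 v %/ aeval t2 v
  | aMod t1 t2 => aeval t1 v %% aeval t2 v
  | aExp t1 t2 => aeval t1 v ^ aeval t2 v
  end.

Fixpoint logistic (r x0 : rat) (n : nat) : rat :=
  match n with
  | 0 => x0
  | m.+1 => (r * logistic r x0 m * (1 - logistic r x0 m))%R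
  end.

Fixpoint logistic_den (b q n : nat) : nat :=
  match n with
  | 0 => b
  | m.+1 => q * logistic_den b q m ^ 2
  end.

(* If a <= b and p <= 4 * q then the numerator never exceeds the denominator
   (because 4 * u * (v - u) <= v ^ 2), so the subtraction is not truncated. *)
Fixpoint logistic_num (a b p q n : nat) : nat :=
  match n with
  | 0 => a
  | m.+1 => p * logistic_num a b p q m *
              (logistic_den b q m - logistic_num a b p q m)
  end.

(* Main.v *)
Require Import Defs.
From mathcomp Require Import all_boot all_order all_algebra.
From mathcomp Require Import zify ring.

Set Implicit Arguments.
Unset Strict Implicit.
Unset Printing Implicit Defensive.

(* Over the common denominator B = b(n), the numerators c i = a(i) B / b(i) satisfy
   q B c(i+1) + p c(i)^2 = p B c(i), with coefficients independent of i.  Code them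
   as C = sum_i c i W^(2^i) for a large W = 2^w, and let J = sum_i W^(2^i).  The
   digit of C^2 at the place 2^(i+1) is c(i)^2 and that of C J is c i, so the
   recurrence says that q B C + p C^2 and p B C J agree at the places 2^1, ..., 2^n.
   By Lucas' theorem modulo 2, the condition that the digits of a number vanish
   outside prescribed places is the parity of a binomial coefficient, so that C is
   determined by a system of exponential polynomial equations with a unique
   solution.  The number of solutions of such a system in a box is an arithmetic
   term (Mazzanti, Marchenkov): it is read off the binary weight of a sum over the
   box that splits into products of sums of x^e c^x, the binary weight of m being
   the 2-adic valuation of 'C(2 m, m). *)

(** * Digits and binary weight *)

Definition digit t c i := c %/ t ^ i %% t.

Lemma sum_digits_lt W N (d : nat -> nat) :
  (forall i, i < N -> d i < W) -> \sum_(i < N) d i * W ^ i < W ^ N.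
Proof.
elim: N => [|N IH] dW; first by rewrite big_ord0.
rewrite big_ord_recr /= expnS.
have dW' i : i < N -> d i < W by move/leqW/dW.
apply: (@leq_trans ((d N).+1 * W ^ N)); last by rewrite leq_mul2r dW ?orbT.
by rewrite mulSn ltn_add2r IH.
Qed.

Lemma digit_sum W N (d : nat -> nat) l :
  (forall i, i < N -> d i < W) -> l < N ->
  digit W (\sum_(i < N) d i * W ^ i) l = d l.
Proof.
rewrite /digit; elim: N => [|N IH] // dW lN; rewrite big_ord_recr /=.
have W0 : 0 < W by apply: leq_ltn_trans (dW N (leqnn _)).
have dW' i : i < N -> d i < W by move/leqW/dW.
move: lN; rewrite ltnS leq_eqVlt => /predU1P[->|lN].
  rewrite addnC divnMDl ?expn_gt0 ?W0 // divn_small ?sum_digits_lt // addn0.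
  by rewrite modn_small ?dW.
have -> : W ^ N = W ^ (N - l.+1) * W * W ^ l.
  by rewrite -expnSr -expnD; congr (_ ^ _); lia.
by rewrite !mulnA addnC divnMDl ?expn_gt0 ?W0 // modnMDl IH.
Qed.

Lemma sum_digits W N c : c < W ^ N -> \sum_(i < N) digit W c i * W ^ i = c.
Proof.
elim: N c => [|N IH] c; first by rewrite big_ord0; case: c.
rewrite expnS => cW; rewrite big_ord_recl /digit expn0 divn1 muln1.
have W0 : 0 < W by case: W cW {IH} => [|//]; rewrite mul0n.
rewrite [RHS](divn_eq c W) addnC; congr (_ + _).
rewrite -[in RHS](IH (c %/ W)) ?ltn_divLR 1?mulnC // big_distrr /=.
by apply: eq_bigr => i _; rewrite /bump /= add1n expnS divnMA mulnCA.
Qed.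

Lemma digits_inj W N (d e : nat -> nat) :
  (forall i, i < N -> d i < W) -> (forall i, i < N -> e i < W) ->
  \sum_(i < N) d i * W ^ i = \sum_(i < N) e i * W ^ i ->
  forall i, i < N -> d i = e i.
Proof. by move=> dW eW de i iN; rewrite -(digit_sum dW iN) de digit_sum. Qed.

Lemma sum_ord_mul m n (F : nat -> nat) :
  \sum_(i < m * n) F i = \sum_(i < m) \sum_(j < n) F (i * n + j).
Proof.
elim: m => [|m IH]; first by rewrite mul0n !big_ord0.
by rewrite mulSnr big_split_ord /= IH big_ord_recr.
Qed.

(** Collecting equal exponents turns a sum over any finite type into an expansion in powers of [X],
    whose digits can be read off when the coefficients stay below [X]. *)
Lemma sum_powers (I : finType) (P : pred I) (h f : I -> nat) X N :
  (forall i, P i -> h i < N) ->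
  \sum_(i | P i) f i * X ^ h i =
    \sum_(k < N) (\sum_(i | P i && (h i == k)) f i) * X ^ k.
Proof.
move=> hN; case: N hN => [|N] hN.
  by rewrite big_ord0 big1 // => i /hN.
rewrite (partition_big (fun i => inord (h i) : 'I_N.+1) xpredT) //=.
apply: eq_bigr => k _; rewrite big_distrl /=.
rewrite (eq_bigl (fun i => P i && (h i == k))); last first.
  move=> i; case Pi: (P i) => //=; rewrite -val_eqE /= inordK //; exact: hN.
by apply: eq_bigr => i /andP[_ /eqP->].
Qed.

(** By Kummer's theorem this counts the ones in the binary expansion of [n]: adding [n] to itself
    carries exactly once at each of them. *)
Definition hw n := logn 2 'C(n.*2, n).

Lemma logn_fact_double n : logn 2 (n.*2)`! = n + logn 2 n`!.
Proof.
elim: n => [|n IH] //; rewrite doubleS !factS -doubleS.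
have odd_lg : logn 2 n.*2.+1 = 0 by rewrite lognE /= dvdn2 /= odd_double.
rewrite !lognM ?muln_gt0 ?fact_gt0 // IH odd_lg -muln2 lognM // (pfactorK 1) //.
by lia.
Qed.

(** Legendre's formula at the prime 2; the recursion of [hw] on binary digits follows from it. *)
Lemma hw_fact n : hw n + logn 2 n`! = n.
Proof.
have: logn 2 ('C(n.*2, n) * (n`! * (n.*2 - n)`!)) = logn 2 (n.*2)`!.
  by rewrite bin_fact // -addnn leq_addr.
rewrite logn_fact_double -{2}addnn addnK.
rewrite !lognM ?muln_gt0 ?fact_gt0 ?bin_gt0 -?addnn ?leq_addr //.
by rewrite /hw -addnn; lia.
Qed.

Lemma hw0 : hw 0 = 0. Proof. by []. Qed.

Lemma hw_double n : hw n.*2 = hw n.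
Proof. by have := hw_fact n.*2; have := hw_fact n; rewrite logn_fact_double; lia. Qed.

Lemma hw_doubleS n : hw n.*2.+1 = (hw n).+1.
Proof.
have := hw_fact n.*2.+1; have := hw_fact n.
rewrite factS lognM ?fact_gt0 // logn_fact_double.
have -> : logn 2 n.*2.+1 = 0 by rewrite lognE /= dvdn2 /= odd_double.
lia.
Qed.

Lemma hw_half n : hw n = odd n + hw n./2.
Proof.
by rewrite -[in LHS](odd_double_half n); case: (odd n); rewrite ?hw_doubleS ?hw_double.
Qed.

Lemma hw_block L x y : x < 2 ^ L -> hw (y * 2 ^ L + x) = hw y + hw x.
Proof.
elim: L x => [|L IH] x; first by case: x => // _; rewrite muln1 addn0 hw0 addn0.
rewrite expnS => xL; rewrite hw_half [hw x]hw_half.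
have -> : y * (2 * 2 ^ L) = (y * 2 ^ L).*2 by rewrite -muln2; ring.
rewrite oddD odd_double /= halfD odd_double /= add0n doubleK IH; last by lia.
lia.
Qed.

(** [2 ^ u - y.+1] is the bitwise complement of [y] among [u] bits. *)
Lemma hw_compl u y : y < 2 ^ u -> hw y + hw (2 ^ u - y.+1) = u.
Proof.
elim: u y => [|u IH] y; first by case: y.
rewrite expnS => yu; rewrite (hw_half y) (hw_half (_ - _)).
have -> : odd (2 * 2 ^ u - y.+1) = ~~ odd y by rewrite oddB // mul2n odd_double.
have -> : (2 * 2 ^ u - y.+1)./2 = 2 ^ u - (y./2).+1 by lia.
have := IH y./2; move: (odd y); lia.
Qed.

Lemma hw_mersenne u x : 0 < x -> x <= 2 ^ u -> hw (x * (2 ^ u - 1)) = u.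
Proof.
case: x => // x _ xu.
(* The high block is [x] and the low block its complement in [u] bits, so the weights add up to [u]
   whatever [x] is. *)
have -> : x.+1 * (2 ^ u - 1) = x * 2 ^ u + (2 ^ u - x.+1).
  by move: (2 ^ u) xu => P; nia.
rewrite hw_block ?hw_compl //; lia.
Qed.

Lemma hw_sum w N (d : nat -> nat) : (forall i, i < N -> d i < 2 ^ w) ->
  hw (\sum_(i < N) d i * (2 ^ w) ^ i) = \sum_(i < N) hw (d i).
Proof.
elim: N => [|N IH] dW; first by rewrite !big_ord0.
have dW' i : i < N -> d i < 2 ^ w by move/leqW/dW.
rewrite !big_ord_recr /= addnC -expnM hw_block; last first.
  by rewrite expnM sum_digits_lt.
by rewrite IH // addnC.
Qed.

(** * Lucas' theorem modulo 2 *)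

Lemma bin_parity m x : (odd 'C(m.*2, x.*2) = odd 'C(m, x)) /\
  (odd 'C(m.*2, x.*2.+1) = false).
Proof.
elim: m x => [|m IH] x; first by case: x.
have [e o] := IH x; rewrite doubleS; split.
  case: x e o => [|x] e o; first by rewrite !bin0.
  rewrite doubleS !binS !oddD -doubleS e (IH x).1 (IH x).2.
  by case: odd; case: odd.
by case: x e o => [|x] e o; rewrite !binS !oddD ?o ?(IH x).2 ?bin0 //=; case: odd.
Qed.

Lemma odd_bin_half m x :
  odd 'C(m, x) = odd 'C(m./2, x./2) && (odd x ==> odd m).
Proof.
rewrite -[in LHS](odd_double_half m) -[in LHS](odd_double_half x).
have [e o] := bin_parity m./2 x./2.
case: (odd x); case: (odd m) => /=; rewrite ?add0n ?add1n ?binS ?oddD ?e ?o ?andbT ?andbF //.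
case: (x./2) e o => [|y] e o; first by rewrite !bin0.
by rewrite doubleS binS oddD -doubleS e (bin_parity _ y).2 addbF.
Qed.

(** Peeling off one binary digit at a time with [odd_bin_half] extends Lucas' theorem to blocks of
    [L] bits. *)
Lemma odd_bin_block L m x m0 x0 : m0 < 2 ^ L -> x0 < 2 ^ L ->
  odd 'C(m * 2 ^ L + m0, x * 2 ^ L + x0) = odd 'C(m, x) && odd 'C(m0, x0).
Proof.
elim: L m0 x0 => [|L IH] m0 x0.
  by case: m0 => // _; case: x0 => // _; rewrite !muln1 !addn0 andbT.
rewrite expnS => mL xL; rewrite odd_bin_half [odd 'C(m0, x0)]odd_bin_half.
have E y : y * (2 * 2 ^ L) = (y * 2 ^ L).*2 by rewrite -muln2; ring.
rewrite !E !oddD !odd_double /= !halfD !odd_double /= !add0n !doubleK IH; lia.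
Qed.

Lemma odd_bin_ones u x : x < 2 ^ u -> odd 'C(2 ^ u - 1, x).
Proof.
elim: u x => [|u IH] x; first by case: x.
rewrite expnS => xu; rewrite odd_bin_half.
have -> : odd (2 * 2 ^ u - 1) by rewrite oddB ?muln_gt0 ?expn_gt0 // mul2n odd_double.
have -> : (2 * 2 ^ u - 1)./2 = 2 ^ u - 1 by lia.
rewrite implybT andbT IH //; lia.
Qed.

Lemma odd_bin_leq m x : odd 'C(m, x) -> x <= m.
Proof. by apply: contraTT; rewrite -ltnNge => /bin_small->. Qed.

Lemma odd_bin_digits w N (m x : nat -> nat) :
  (forall i, i < N -> m i < 2 ^ w) -> (forall i, i < N -> x i < 2 ^ w) ->
  odd 'C(\sum_(i < N) m i * (2 ^ w) ^ i, \sum_(i < N) x i * (2 ^ w) ^ i) =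
    [forall i : 'I_N, odd 'C(m i, x i)].
Proof.
elim: N => [|N IH] mW xW.
  by rewrite !big_ord0; symmetry; apply/forallP; case.
have mW' i : i < N -> m i < 2 ^ w by move/leqW/mW.
have xW' i : i < N -> x i < 2 ^ w by move/leqW/xW.
rewrite !big_ord_recr /= addnC [X in 'C(_, X)]addnC -expnM.
rewrite odd_bin_block ?expnM ?sum_digits_lt // IH //.
apply/andP/forallP => [[oN /forallP o] i|o]; last first.
  split; first exact: (o ord_max).
  by apply/forallP => i; apply: (o (widen_ord (leqnSn N) i)).
have := ltn_ord i; rewrite ltnS leq_eqVlt => /predU1P[->//|iN].
exact: (o (Ordinal iN)).
Qed.

(** * Arithmetic terms *)

Lemma bin_leq_exp2 n k : 'C(n, k) <= 2 ^ n.
Proof.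
have [kn|nk] := leqP k n; last by rewrite bin_small.
rewrite -[2]/(1 + 1) expnDn (bigD1 (Ordinal (kn : k < n.+1))) //=.
by rewrite !exp1n !muln1 leq_addr.
Qed.

Lemma exp_succ_digits n X : (1 + X) ^ n = \sum_(i < n.+1) 'C(n, i) * X ^ i.
Proof. by rewrite expnDn; apply: eq_bigr => i _; rewrite exp1n mul1n. Qed.

(** The base [2 ^ n.+1] exceeds every coefficient of [(1 + X) ^ n], so these coefficients are its
    digits; for [k > n] both sides vanish. *)
Lemma bin_closed_form n k :
  'C(n, k) = (1 + 2 ^ n.+1) ^ n %/ (2 ^ n.+1) ^ k %% 2 ^ n.+1.
Proof.
have binX i : i < n.+1 -> 'C(n, i) < 2 ^ n.+1.
  by move=> _; rewrite (leq_ltn_trans (bin_leq_exp2 n i)) // ltn_exp2l.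
rewrite exp_succ_digits; have [kn|nk] := ltnP k n.+1; first by rewrite -/(digit _ _ _) digit_sum.
rewrite bin_small // divn_small ?mod0n //.
by apply: leq_trans (sum_digits_lt binX) _; rewrite leq_exp2l // -[1]/(2 ^ 0) ltn_exp2l.
Qed.

Lemma sum_dvdn d m : 0 < d -> \sum_(i < m * d) (d %| i) = m.
Proof.
move=> d0; rewrite (sum_ord_mul _ _ (fun i => (d %| i) : nat)).
rewrite -[RHS]mul1n -[X in _ = _ * X]card_ord mulnC -sum_nat_const.
apply: eq_bigr => i _; case: d d0 => // d _.
rewrite big_ord_recl /= addn0 dvdn_mull // big1 // => j _.
by rewrite dvdn_addr ?dvdn_mull // gtnNdvd //= /bump /= add1n ltnS.
Qed.

(** An [i] admits a [j] exactly when it is a multiple of [b %/ gcdn a b], and [j] is then unique.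
    The range [i < b] leaves out the pair [(b, 0)], which would make one solution too many. *)
Lemma gcdn_count a b : 0 < a -> 0 < b ->
  \sum_(i < b) \sum_(j < a.+1) (a * i + b * j == a * b) = gcdn a b.
Proof.
move=> a0 b0; set g := gcdn a b; have g0 : 0 < g by rewrite gcdn_gt0 a0.
have db : b = g * (b %/ g) by rewrite mulnC divnK // dvdn_gcdr.
have d0 : 0 < b %/ g by rewrite divn_gt0 // dvdn_leq ?dvdn_gcdr.
rewrite -[RHS](sum_dvdn g d0) -db; apply: eq_bigr => i _.
have -> : (b %/ g %| i) = (b %| a * i).
  move: (nat_of_ord i) => {}i.
  have da : a = g * (a %/ g) by rewrite mulnC divnK // dvdn_gcdl.
  transitivity (g * (b %/ g) %| g * (a %/ g * i)); last by rewrite mulnA -db -da.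
  rewrite dvdn_pmul2l // Gauss_dvdr // /coprime.
  by rewrite -(eqn_pmul2l g0) muln1 muln_gcdr -db -da gcdnC.
have [/dvdnP[q aiq]|ndvd] := boolP (b %| a * i); last first.
  rewrite big1 // => j _; case: eqP => // abij; case/negP: ndvd.
  by rewrite -(dvdn_addl (a * i) (dvdn_mulr j (dvdnn b))) abij dvdn_mull.
have qa : q < a by rewrite -(ltn_pmul2r b0) -aiq ltn_pmul2l.
rewrite (bigD1 (inord (a - q))) //= inordK ?ltnS ?leq_subr // big1 => [|j].
  by rewrite addn0 aiq mulnBr [b * a]mulnC [b * q]mulnC subnKC ?eqxx // leq_pmul2r // ltnW.
rewrite -val_eqE /= inordK ?ltnS ?leq_subr // => nj; case: eqP => // e.
case/eqP: nj; apply/eqP; rewrite -(eqn_pmul2l b0); nia.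
Qed.

Lemma geometric_sum X n : 1 < X -> \sum_(i < n) X ^ i = (X ^ n - 1) %/ (X - 1).
Proof. by move=> X1; rewrite !subn1 predn_exp mulKn //; lia. Qed.

(* The number of pairs (i, j) with a * i + b * j = a * b is the coefficient of
   X ^ (a * b) in a product of two geometric series. *)
Lemma gcdn_closed_form a b (X := 2 ^ (b * a.+1)) : 0 < a -> 0 < b ->
  gcdn a b = ((X ^ a) ^ b - 1) %/ (X ^ a - 1) *
             (((X ^ b) ^ a.+1 - 1) %/ (X ^ b - 1)) %/ X ^ (a * b) %% X.
Proof.
move=> a0 b0; have X1 : 1 < X by rewrite /X -[1]/(2 ^ 0) ltn_exp2l // muln_gt0 b0.
rewrite -!geometric_sum; try by rewrite -(exp1n a) ltn_exp2r.
  2: by rewrite -(exp1n b) ltn_exp2r.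
rewrite big_distrl /= (eq_bigr (fun i : 'I_b => \sum_(j < a.+1) X ^ (a * i + b * j))); last first.
  by move=> i _; rewrite big_distrr; apply: eq_bigr => j _; rewrite expnD !expnM.
rewrite pair_big /=.
pose h (p : 'I_b * 'I_a.+1) := a * p.1 + b * p.2.
rewrite (eq_bigr (fun p => 1 * X ^ h p)) => [|p _]; last by rewrite mul1n.
rewrite (@sum_powers _ xpredT h (fun=> 1) X (a * b + b * a.+1)) => [|p _]; last first.
  rewrite /h -addnS leq_add //; first by rewrite leq_pmul2l // ltnW.
  by rewrite ltn_pmul2l.
rewrite -/(digit _ _ _) (@digit_sum X _ (fun k => \sum_(p | h p == k) 1)) => [|k _|]; last first.
- by rewrite -[X in X < _]addn0 ltn_add2l muln_gt0 b0.
- rewrite sum1_card; apply: leq_ltn_trans (max_card _) _.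
  by rewrite card_prod !card_ord /X ltn_expl.
- rewrite -gcdn_count // pair_big [RHS]big_mkcond /=.
  by apply: eq_bigr => p _; rewrite /h; case: eqP.
Qed.

Lemma hw_le n : hw n <= n. Proof. by have := hw_fact n; lia. Qed.

(** As [hw n <= n], the number [2 ^ n] is a multiple of the full power of 2 in the central binomial
    coefficient, and the gcd isolates that power. *)
Lemma gcdn_central_bin n : gcdn 'C(n.*2, n) (2 ^ n) = 2 ^ hw n.
Proof.
have C0 : 0 < 'C(n.*2, n) by rewrite bin_gt0 -addnn leq_addr.
have [o] := pfactor_coprime (isT : prime 2) C0; rewrite -/(hw n) => co ->.
have -> : 2 ^ n = 2 ^ (n - hw n) * 2 ^ hw n by rewrite -expnD subnK ?hw_le.
rewrite -muln_gcdl.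
by rewrite [gcdn _ _](_ : _ = 1) ?mul1n //; apply/eqP; rewrite gcdnC; apply: coprimeXl.
Qed.

(* (1 + x) ^ h = 1 + h x modulo x ^ 2, with x = 2 ^ s - 1. *)
Lemma log2_closed_form h s : h.+1 < s -> h = (2 ^ h) ^ s %% (2 ^ s - 1) ^ 2 %/ (2 ^ s - 1).
Proof.
move=> hs; have : s < 2 ^ s by rewrite ltn_expl.
rewrite -expnM mulnC expnM; have -> : 2 ^ s = 1 + (2 ^ s - 1) by rewrite subnKC ?expn_gt0.
move: (2 ^ s - 1) => x; rewrite addKn add1n ltnS => sx.
have -> : x.+1 ^ h = 1 + h * x %[mod x ^ 2].
  elim: h {hs} => [|h IH]; first by rewrite mul0n.
  rewrite expnSr -modnMml IH modnMml.
  have -> : (1 + h * x) * x.+1 = h * x ^ 2 + (1 + h.+1 * x) by rewrite expnS expn1; ring.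
  by rewrite modnMDl.
have x1 : h.+1 < x by lia.
rewrite modn_small; last by rewrite expnS expn1; nia.
by rewrite addnC divnMDl ?divn_small ?addn0 //; lia.
Qed.

(** * Closure properties of the functions computed by terms *)

Definition arith k (f : k.-tuple nat -> nat) := exists t : aterm k, forall v, aeval t v = f v.

Section Arith.

Variable k : nat.
Implicit Types f g : k.-tuple nat -> nat.

Lemma arith_ext f g : f =1 g -> arith f -> arith g.
Proof. by move=> fg [t tf]; exists t => v; rewrite tf fg. Qed.

Lemma arith_const c : arith (fun _ : k.-tuple nat => c).
Proof. by exists (aConst k c). Qed.

Lemma arith_var i : arith (fun v : k.-tuple nat => tnth v i).
Proof. by exists (aVar i). Qed.

Lemma arithD f g : arith f -> arith g -> arith (fun v => f v + g v).
Proof. by move=> [s sf] [t tg]; exists (aAdd s t) => v /=; rewrite sf tg. Qed.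

Lemma arithB f g : arith f -> arith g -> arith (fun v => f v - g v).
Proof. by move=> [s sf] [t tg]; exists (aMonus s t) => v /=; rewrite sf tg. Qed.

Lemma arithM f g : arith f -> arith g -> arith (fun v => f v * g v).
Proof. by move=> [s sf] [t tg]; exists (aMul s t) => v /=; rewrite sf tg. Qed.

Lemma arith_div f g : arith f -> arith g -> arith (fun v => f v %/ g v).
Proof. by move=> [s sf] [t tg]; exists (aDiv s t) => v /=; rewrite sf tg. Qed.

Lemma arith_mod f g : arith f -> arith g -> arith (fun v => f v %% g v).
Proof. by move=> [s sf] [t tg]; exists (aMod s t) => v /=; rewrite sf tg. Qed.

Lemma arithX f g : arith f -> arith g -> arith (fun v => f v ^ g v).
Proof. by move=> [s sf] [t tg]; exists (aExp s t) => v /=; rewrite sf tg. Qed.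

Lemma arithS f : arith f -> arith (fun v => (f v).+1).
Proof.
by move=> af; apply: arith_ext (arithD af (arith_const 1)) => v; rewrite addn1.
Qed.

End Arith.

Ltac arith_step :=
  match goal with
  | H : arith ?f |- arith ?f => exact H
  | H : arith ?f |- arith (fun v => ?f v) => exact H
  | |- arith (fun _ => ?c) => exact: arith_const
  | |- arith (fun v => tnth v ?i) => exact: arith_var
  | |- arith (fun v => @?f v + @?g v) => apply: (@arithD _ f g)
  | |- arith (fun v => @?f v - @?g v) => apply: (@arithB _ f g)
  | |- arith (fun v => @?f v * @?g v) => apply: (@arithM _ f g)
  | |- arith (fun v => @?f v %/ @?g v) => apply: (@arith_div _ f g)
  | |- arith (fun v => @?f v %% @?g v) => apply: (@arith_mod _ f g)
  | |- arith (fun v => @?f v ^ @?g v) => apply: (@arithX _ f g)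
  | |- arith (fun v => (@?f v).+1) => apply: (@arithS _ f)
  end.
Ltac arith_tac := repeat arith_step.

Lemma arith_bin k (f g : k.-tuple nat -> nat) :
  arith f -> arith g -> arith (fun v => 'C(f v, g v)).
Proof.
move=> af ag; apply: arith_ext (fun v => esym (bin_closed_form _ _)) _; arith_tac.
Qed.

Lemma arith_hw k (f : k.-tuple nat -> nat) : arith f -> arith (fun v => hw (f v)).
Proof.
move=> af.
pose c v := 'C(f v + f v, f v); pose d v := 2 ^ f v.
pose X v := 2 ^ (d v * (c v).+1).
pose g v := ((X v ^ c v) ^ d v - 1) %/ (X v ^ c v - 1) *
  (((X v ^ d v) ^ (c v).+1 - 1) %/ (X v ^ d v - 1)) %/ X v ^ (c v * d v) %% X v.
have gE v : g v = 2 ^ hw (f v).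
  rewrite -gcdn_central_bin gcdn_closed_form ?expn_gt0 ?bin_gt0 -?addnn ?leq_addr //.
have ac : arith c by apply: arith_bin; arith_tac.
have ad : arith d by rewrite /d; arith_tac.
have aX : arith X by rewrite /X; arith_tac.
have ag : arith g by rewrite /g; arith_tac.
(* Since [hw (f v) <= f v], the choice [s = f v + 2] satisfies the condition of
   [log2_closed_form]. *)
apply: (@arith_ext _ (fun v => g v ^ ((f v).+2) %% (2 ^ (f v).+2 - 1) ^ 2 %/ (2 ^ (f v).+2 - 1))).
  by move=> v; rewrite gE -log2_closed_form // !ltnS hw_le.
by arith_tac.
Qed.

Lemma arith_sum k m (F : nat -> k.-tuple nat -> nat) :
  (forall i, i < m -> arith (F i)) -> arith (fun v => \sum_(i < m) F i v).
Proof.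
elim: m => [|m IH] aF.
  by apply: arith_ext (arith_const k 0) => v; rewrite big_ord0.
apply: arith_ext (arithD (IH (fun i im => aF i (leqW im))) (aF m (leqnn _))) => v.
by rewrite big_ord_recr.
Qed.

Lemma arith_prod k m (F : nat -> k.-tuple nat -> nat) :
  (forall i, i < m -> arith (F i)) -> arith (fun v => \prod_(i < m) F i v).
Proof.
elim: m => [|m IH] aF.
  by apply: arith_ext (arith_const k 1) => v; rewrite big_ord0.
apply: arith_ext (arithM (IH (fun i im => aF i (leqW im))) (aF m (leqnn _))) => v.
by rewrite big_ord_recr.
Qed.

Definition geo e c t := \sum_(x < t) x ^ e * c ^ x.

(* Summation by parts: expand (x + 1) ^ e * c ^ (x + 1) - x ^ e * c ^ x. *)
Lemma geo_rec e c t :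
  c * (\sum_(j < e.+1) 'C(e, j) * geo j c t) + 0 ^ e = t ^ e * c ^ t + geo e c t.
Proof.
elim: t => [|t IH].
  by rewrite /geo big_ord0 addn0 muln1 big1 ?muln0 // => j _; rewrite big_ord0 muln0.
have geoS j : geo j c t.+1 = geo j c t + t ^ j * c ^ t by rewrite /geo big_ord_recr.
under eq_bigr => j _ do rewrite geoS mulnDr mulnA.
rewrite big_split /= -big_distrl /= mulnDr addnAC IH geoS.
rewrite expnS -[t.+1]add1n exp_succ_digits mulnCA.
by rewrite -addnA addnC [geo _ _ _ + _]addnC addnA mulnCA.
Qed.

(** Strong induction on the fixed exponent [e]: [geo_rec] is a linear equation for [geo e] with
    coefficient [c - 1 > 0], so an exact division solves it. *)
Lemma arith_geo k e (c t : k.-tuple nat -> nat) : (forall v, 1 < c v) ->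
  arith c -> arith t -> arith (fun v => geo e (c v) (t v)).
Proof.
move=> c1 ac at_; elim/ltn_ind: e => e IH.
have aS : arith (fun v => \sum_(j < e) 'C(e, j) * geo j (c v) (t v)).
  apply: (@arith_sum _ _ (fun j v => 'C(e, j) * geo j (c v) (t v))) => j je.
  by apply: arithM; [exact: arith_const | exact: IH].
pose S v := \sum_(j < e) 'C(e, j) * geo j (c v) (t v).
apply: (@arith_ext _ (fun v => (t v ^ e * c v ^ t v - (c v * S v + 0 ^ e)) %/ (c v - 1))).
  move=> v; have := geo_rec e (c v) (t v); rewrite big_ord_recr /= binn mul1n -/(S v).
  rewrite mulnDr; move: (t v ^ e * c v ^ t v) (geo _ _ _) (S v) (0 ^ e) (c1 v) => A G T z c1v H.
  have -> : A - (c v * T + z) = G * (c v - 1) by rewrite mulnBr muln1 [G * _]mulnC; lia.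
  by rewrite mulnK // subn_gt0.
by rewrite /S; arith_tac.
Qed.

(** * Counting solutions of exponential polynomial equations *)

Lemma digit_mulD t m i j l : l < m -> digit t (i * t ^ m + j) l = digit t j l.
Proof.
move=> lm; rewrite /digit; case: t => [|t]; first by rewrite exp0n ?muln0 //; lia.
have -> : t.+1 ^ m = t.+1 ^ (m - l.+1) * t.+1 * t.+1 ^ l.
  by rewrite -expnSr -expnD; congr (_ ^ _); lia.
by rewrite !mulnA divnMDl ?expn_gt0 // modnMDl.
Qed.

Lemma digit_top t m i j : i < t -> j < t ^ m -> digit t (i * t ^ m + j) m = i.
Proof.
move=> it jt; rewrite /digit divnMDl; last by apply: leq_ltn_trans jt.
by rewrite divn_small // addn0 modn_small.
Qed.

(** The base [t] digits of [c < t ^ m] run through all points of the box, so a sum of products of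
    functions of single digits factors. *)
Lemma sum_box_prod t m (g : nat -> nat -> nat) :
  \sum_(c < t ^ m) \prod_(i < m) g i (digit t c i) =
    \prod_(i < m) \sum_(x < t) g i x.
Proof.
elim: m => [|m IH].
  by rewrite !big_ord0 expn0 big_ord1 big_ord0.
rewrite expnS (sum_ord_mul _ _ (fun c => \prod_(i < m.+1) g i (digit t c i))).
rewrite [RHS]big_ord_recr /= -IH big_distrr /=; apply: eq_bigr => i _.
rewrite big_distrl /=; apply: eq_bigr => j _.
rewrite big_ord_recr /= digit_top //; congr (_ * _).
by apply: eq_bigr => l _; rewrite digit_mulD.
Qed.

(* Sums of monomials in x i and c ^ x i whose coefficients and bases c are
   arithmetic terms in the parameters v. *)
Inductive exp_poly k m : (k.-tuple nat -> (nat -> nat) -> nat) -> Prop :=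
| ExpMon g (e : nat -> nat) (c : nat -> k.-tuple nat -> nat) of arith g & (forall i, arith (c i)) &
    (forall i v, 0 < c i v) :
    exp_poly m (fun v x => g v * \prod_(i < m) (x i ^ e i * c i v ^ x i))
| ExpAdd f g of exp_poly m f & exp_poly m g : exp_poly m (fun v x => f v x + g v x)
| ExpExt f g of exp_poly m f & (forall v x, f v x = g v x) : exp_poly m g.

Section ExpPoly.

Variables k m : nat.
Implicit Types (f g : k.-tuple nat -> (nat -> nat) -> nat) (h t : k.-tuple nat -> nat).

Lemma exp_poly_const h : arith h -> exp_poly m (fun v _ => h v).
Proof.
move=> ah; apply: (ExpExt (@ExpMon k m h (fun=> 0) (fun _ _ => 1) ah _ _)) => // [i|v x].
  exact: arith_const.
by rewrite big1 ?muln1 // => i _; rewrite exp1n.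
Qed.

Lemma exp_poly_var i : i < m -> exp_poly m (fun (_ : k.-tuple nat) x => x i).
Proof.
move=> im; apply: (ExpExt (@ExpMon k m (fun=> 1) (fun j => j == i) (fun _ _ => 1) _ _ _)) => //.
- exact: arith_const.
- by move=> j; apply: arith_const.
move=> v x; rewrite mul1n (bigD1 (Ordinal im)) //= eqxx exp1n muln1 big1 ?muln1 // => j.
by rewrite -val_eqE /= exp1n => /negPf->.
Qed.

Lemma exp_poly_exp h i : i < m -> arith h -> (forall v, 0 < h v) ->
  exp_poly m (fun v x => h v ^ x i).
Proof.
move=> im ah h0; pose c j v := if j == i then h v else 1.
apply: (ExpExt (@ExpMon k m (fun=> 1) (fun=> 0) c _ _ _)).
- exact: arith_const.
- by move=> j; rewrite /c; case: eqP => // _; apply: arith_const.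
- by move=> j v; rewrite /c; case: eqP.
move=> v x; rewrite mul1n (bigD1 (Ordinal im)) //= /c eqxx mul1n big1 ?muln1 // => j.
by rewrite -val_eqE /= mul1n => /negPf->; rewrite exp1n.
Qed.

Lemma exp_polyM f g : exp_poly m f -> exp_poly m g -> exp_poly m (fun v x => f v x * g v x).
Proof.
move=> epf; elim: epf g => {f} [h e c ah ac c0 g|f1 f2 _ IH1 _ IH2 g epg|f1 f2 _ IH fE g epg].
- elim=> {g} [h' e' c' ah' ac' c0'|g1 g2 _ IH1 _ IH2|g1 g2 _ IH gE].
  + apply: (ExpExt (@ExpMon k m (fun v => h v * h' v) (fun i => e i + e' i)
                     (fun i v => c i v * c' i v) _ _ _)).
    * exact: arithM.
    * by move=> i; apply: arithM.
    * by move=> i v; rewrite muln_gt0 c0 c0'.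
    move=> v x; rewrite mulnACA -big_split /=; congr (_ * _).
    by apply: eq_bigr => i _; rewrite expnD expnMn mulnACA.
  + by apply: (ExpExt (ExpAdd IH1 IH2)) => v x; rewrite mulnDr.
  + by apply: (ExpExt IH) => v x; rewrite gE.
- by apply: (ExpExt (ExpAdd (IH1 g epg) (IH2 g epg))) => v x; rewrite mulnDl.
- by apply: (ExpExt (IH g epg)) => v x; rewrite fE.
Qed.

Lemma exp_poly_bound f t : arith t -> exp_poly m f ->
  exists2 b, arith b & forall v x, (forall i, x i < t v) -> f v x <= b v.
Proof.
move=> at_; elim=> {f} [h e c ah ac c0|f g _ [b ab fb] _ [d ad gd]|f g _ [b ab fb] fg].
- exists (fun v => h v * \prod_(i < m) (t v ^ e i * c i v ^ t v)).
    apply: arithM => //; apply: (@arith_prod k m (fun i v => t v ^ e i * c i v ^ t v)) => i _.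
    by have ai := ac i; arith_tac.
  move=> v x xt; rewrite leq_mul2l; apply/orP; right.
  apply: leq_prod => i _; apply: leq_mul.
    by case: (e i) => [|d] //; rewrite leq_exp2r // ltnW.
  by rewrite leq_pexp2l ?c0 // ltnW.
- by exists (fun v => b v + d v); [exact: arithD | move=> v x xt; rewrite leq_add ?fb ?gd].
- by exists b => // v x xt; rewrite -fg fb.
Qed.

(** Expanding the exponent [c] in base [t] gives [Y ^ c] as the product of the [(Y ^ t ^ i) ^ x i].
    A monomial thus leads to a product of sums [geo] with bases above 1. *)
Lemma arith_box_sum f t Y : arith t -> arith Y -> (forall v, 0 < t v) ->
  (forall v, 1 < Y v) -> exp_poly m f ->
  arith (fun v => \sum_(c < t v ^ m) f v (digit (t v) c) * Y v ^ c).
Proof.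
move=> at_ aY t0 Y1; elim=> {f} [h e c ah ac c0|f g _ IHf _ IHg|f g _ IH fg].
- have Yt v i : 0 < Y v ^ t v ^ i by rewrite expn_gt0 ltnW ?Y1.
  apply: (@arith_ext k (fun v => h v * \prod_(i < m) geo (e i) (c i v * Y v ^ (t v ^ i)) (t v))).
    move=> v; rewrite /geo -(sum_box_prod _ _ (fun i x => x ^ e i * (c i v * Y v ^ (t v ^ i)) ^ x)).
    rewrite big_distrr /=; apply: eq_bigr => d _; rewrite -mulnA; congr (_ * _).
    rewrite -[in Y v ^ d](sum_digits (ltn_ord d)) expn_sum -big_split /=; apply: eq_bigr => i _.
    by rewrite expnMn mulnA -expnM [_ * t v ^ _]mulnC.
  apply: arithM => //.
  apply: (@arith_prod k m (fun i v => geo (e i) (c i v * Y v ^ (t v ^ i)) (t v))) => i _.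
  have ai := ac i; apply: arith_geo; try by arith_tac.
  move=> v; apply: (@leq_trans (1 * Y v ^ (t v ^ i))); last by rewrite leq_mul2r c0 orbT.
  by rewrite mul1n -(exp1n (t v ^ i)) ltn_exp2r ?Y1 // expn_gt0 t0.
- apply: arith_ext (arithD IHf IHg) => v; rewrite -big_split /=.
  by apply: eq_bigr => c _; rewrite mulnDl.
- by apply: arith_ext IH => v; apply: eq_bigr => c _; rewrite fg.
Qed.

Definition dioph (Q : k.-tuple nat -> (nat -> nat) -> bool) :=
  exists F G, [/\ exp_poly m F, exp_poly m G, forall v x, G v x <= F v x
    & forall v x, Q v x = (G v x == F v x)].

(* G <= F turns a conjunction of equations into the single equation of the sums;
   an equation f = g is put into this form as 2 f g = f^2 + g^2. *)
Lemma dioph_eq f g : exp_poly m f -> exp_poly m g -> dioph (fun v x => f v x == g v x).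
Proof.
move=> epf epg; exists (fun v x => f v x * f v x + g v x * g v x).
exists (fun v x => f v x * g v x + f v x * g v x); split=> [||v x|v x].
- by apply: ExpAdd; apply: exp_polyM.
- by apply: ExpAdd; apply: exp_polyM.
- by have [] := nat_Cauchy (f v x) (g v x); rewrite -!mulnn mul2n -addnn.
- by have [_] := nat_Cauchy (f v x) (g v x); rewrite -!mulnn mul2n -addnn => ->.
Qed.

Lemma dioph_and Q R : dioph Q -> dioph R -> dioph (fun v x => Q v x && R v x).
Proof.
move=> [F [G [epF epG GF QE]]] [F' [G' [epF' epG' GF' RE]]].
exists (fun v x => F v x + F' v x), (fun v x => G v x + G' v x); split.
- exact: ExpAdd.
- exact: ExpAdd.
- by move=> v x; rewrite leq_add.
- move=> v x; rewrite QE RE; have := GF v x; have := GF' v x; lia.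
Qed.

(* With u large, the block D c * (2 ^ u - 1) of size 2 ^ (2 u) has binary weight u
   if D c != 0 and 0 otherwise, hence the binary weight of the sum of all the
   blocks counts the zeros of D = F - G. *)
Lemma arith_count Q t : arith t -> (forall v, 0 < t v) -> dioph Q ->
  arith (fun v => \sum_(c < t v ^ m) Q v (digit (t v) c)).
Proof.
move=> at_ t0 [F [G [epF epG GF QE]]].
have [b ab Fb] := exp_poly_bound at_ epF.
pose u v := (b v).+1; pose Y v := 2 ^ (u v * 2).
have aY : arith Y by rewrite /Y /u; arith_tac.
have Y1 v : 1 < Y v by rewrite /Y -[1]/(2 ^ 0) ltn_exp2l.
have aF := arith_box_sum at_ aY t0 Y1 epF.
have aG := arith_box_sum at_ aY t0 Y1 epG.
pose SF v := \sum_(c < t v ^ m) F v (digit (t v) c) * Y v ^ c.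
pose SG v := \sum_(c < t v ^ m) G v (digit (t v) c) * Y v ^ c.
pose H v := (SF v - SG v) * (2 ^ u v - 1).
have aH : arith (fun v => hw (H v)).
  by apply: arith_hw; rewrite /H /u; do !apply: arithM => //; arith_tac.
apply: (@arith_ext k (fun v => t v ^ m - hw (H v) %/ u v)); last by rewrite /u; arith_tac.
move=> v; pose D c := F v (digit (t v) c) - G v (digit (t v) c).
have Du c : D c < 2 ^ u v.
  rewrite (leq_ltn_trans (leq_subr _ _)) // (leq_ltn_trans (Fb _ _ _)) => [//|i|].
    by rewrite /digit ltn_mod t0.
  by rewrite (@leq_trans (u v)) // ltnW // ltn_expl.
have -> : H v = \sum_(c < t v ^ m) D c * (2 ^ u v - 1) * (2 ^ (u v * 2)) ^ c.
  rewrite /H /SF /SG; under [RHS]eq_bigr => c _ do rewrite mulnAC.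
  rewrite -big_distrl /=; congr (_ * _).
  (* As [G <= F] at each point, the truncated difference of the two sums is the sum of the [D c]. *)
  have -> : \sum_(c < t v ^ m) F v (digit (t v) c) * Y v ^ c =
      \sum_(c < t v ^ m) D c * Y v ^ c + \sum_(c < t v ^ m) G v (digit (t v) c) * Y v ^ c.
    by rewrite -big_split; apply: eq_bigr => c _ /=; rewrite -mulnDl subnK.
  by rewrite addnK.
rewrite (@hw_sum _ _ (fun c => D c * (2 ^ u v - 1))) => [|c _]; last first.
  rewrite muln2 -addnn expnD; have := Du c; have : 0 < 2 ^ u v by rewrite expn_gt0.
  by move: (2 ^ u v) (D c) => P d; nia.
have -> : \sum_(c < t v ^ m) hw (D c * (2 ^ u v - 1)) =
    \sum_(c < t v ^ m) ~~ Q v (digit (t v) c) * u v.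
  apply: eq_bigr => c _; rewrite QE eqn_leq GF /= -subn_eq0 -/(D c).
  have [->|D0] := eqVneq (D c) 0; first by rewrite mul0n hw0.
  by rewrite mul1n hw_mersenne ?lt0n // ltnW.
rewrite -big_distrl /= mulnK //.
have E : \sum_(c < t v ^ m) Q v (digit (t v) c) + \sum_(c < t v ^ m) ~~ Q v (digit (t v) c) = t v ^ m.
  rewrite -big_split -[RHS]card_ord -sum1_card; apply: eq_bigr => c _ /=.
  by case: (Q _ _).
exact: esym (canRL (addnK _) E).
Qed.

End ExpPoly.

(* The sum of the j-th coordinates counts the pairs (i, y) with y < w i j; the
   three extra variables are N - 1 - i, y and w i j - 1 - y. *)
Lemma arith_sum_unique k m j Q (t N : k.-tuple nat -> nat) :
  0 < m -> j < m -> dioph m.+3 Q -> arith t -> arith N -> (forall v, 0 < t v) ->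
  exists2 f, arith f & forall v (w : nat -> nat -> nat), N v <= t v ->
    (forall i, i < N v -> w i 0 = i) ->
    (forall i l, i < N v -> l < m -> w i l < t v) ->
    (forall x, x 0 < N v -> (forall l, x l < t v) ->
      Q v x <-> (forall l, l < m -> x l = w (x 0) l)) ->
    f v = \sum_(i < N v) w i j.
Proof.
move=> m0 jm dQ at_ aN t0.
pose Q' v x := Q v x && ((x 0 + x m + 1 == N v) && (x m.+1 + x m.+2 + 1 == x j)).
exists (fun v => \sum_(c < t v ^ m.+3) Q' v (digit (t v) c)).
  apply: arith_count => //; apply: dioph_and => //.
  have var l : l < m.+3 -> exp_poly m.+3 (fun (_ : k.-tuple nat) x => x l) by apply: exp_poly_var.
  have cst h : arith h -> exp_poly m.+3 (fun (v : k.-tuple nat) _ => h v) by apply: exp_poly_const.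
  apply: dioph_and; apply: dioph_eq; try (by apply: cst).
  - by do !apply: ExpAdd; [apply: var.. | apply/cst/arith_const]; lia.
  - by do !apply: ExpAdd; [apply: var.. | apply/cst/arith_const]; lia.
  - by apply: var; lia.
move=> v w Nt w0 wt Qw.
pose z i y l := if l < m then w i l else if l == m then N v - 1 - i
                else if l == m.+1 then y else w i j - 1 - y.
(* Reduction modulo [t v] keeps the code inside the box for every pair; on the pairs with
   [y < w i j] it changes nothing. *)
pose code i y := \sum_(l < m.+3) (z i y l %% t v) * t v ^ l.
have zt i y l : z i y l %% t v < t v by rewrite ltn_mod t0.
have code_lt i y : code i y < t v ^ m.+3.
  by apply: (@sum_digits_lt _ _ (fun l => z i y l %% t v)) => l _.
have codeK i y l : l < m.+3 -> digit (t v) (code i y) l = z i y l %% t v.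
  by move=> lm; rewrite /code (@digit_sum _ _ (fun l => z i y l %% t v)).
have zmod i y l : i < N v -> y < w i j -> z i y l %% t v = z i y l.
  move=> iN yw; have wj := wt i j iN jm; have il := wt i l iN.
  rewrite modn_small // /z; case: (ltnP l m) => [/il//|_].
  by case: eqP => _; [|case: eqP => _]; lia.
pose P := [pred p : 'I_(N v) * 'I_(t v) | p.2 < w p.1 j].
pose ocode (p : 'I_(N v) * 'I_(t v)) := Ordinal (code_lt p.1 p.2).
have -> : \sum_(i < N v) w i j = #|P|.
  rewrite -sum1_card (eq_bigl (fun p : 'I_(N v) * 'I_(t v) => xpredT p.1 && (p.2 < w p.1 j))) //.
  rewrite -(pair_big_dep xpredT (fun (i : 'I_(N v)) (y : 'I_(t v)) => y < w i j) (fun _ _ => 1)) /=.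
  apply: eq_bigr => i _; rewrite sum1_card -[LHS]card_ord.
  have wti := ltnW (wt i j (ltn_ord i) jm).
  rewrite -[LHS](card_image (f := widen_ord wti)); last first.
    by move=> x y /(congr1 val) /= xy; apply: val_inj.
  apply: eq_card => y; rewrite [RHS]unfold_in; apply/imageP/idP => [[x _ ->] /=|yw].
    exact: ltn_ord.
  by exists (Ordinal yw) => //; apply: val_inj.
have ocode_inj : {in P &, injective ocode}.
  move=> [i y] [i' y'] /=; rewrite !inE /= => yw yw' /(congr1 val) /= cE.
  have zE l : l < m.+3 -> z i y l = z i' y' l.
    by move=> lm; rewrite -zmod // -codeK // cE codeK // zmod.
  have := zE 0 isT; rewrite /z m0 !w0 // => /val_inj iE.
  have := zE m.+1 (leqW (leqnn _)); rewrite /z ltnNge leqnSn /= gtn_eqF // eqxx => /val_inj yE.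
  by rewrite iE yE.
rewrite -(card_in_image ocode_inj).
rewrite -sum1_card [RHS]big_mkcond /=; apply: eq_bigr => c _.
(* A code solves the system exactly when it encodes a pair of [P], so the solutions are counted by
   the image of the injective coding. *)
rewrite (_ : Q' v _ = (c \in image ocode P)); first by case: ifP.
  set x := digit (t v) c; have xt l : x l < t v by rewrite /x /digit ltn_mod t0.
  apply/idP/imageP => [/and3P[Qx /eqP xN /eqP xj]|[[i y]]].
    have x0N : x 0 < N v by lia.
    have xw := (Qw x x0N xt).1 Qx.
    exists (Ordinal x0N, Ordinal (xt m.+1)); first by rewrite inE /= -xw //; lia.
    apply: val_inj => /=; rewrite -[LHS](sum_digits (ltn_ord c)); apply: eq_bigr => l _.
    congr (_ * _); rewrite zmod -?xw //; last by lia.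
    rewrite -/x /z; have := ltn_ord l.
    case: (ltnP l m) => [lm _|ml lm]; first by rewrite xw.
    case: eqP => [->|lm']; first lia.
    case: eqP => [->//|lm'']; rewrite -xw // (_ : nat_of_ord l = m.+2); lia.
  rewrite inE /= => yw cE.
  have xz l : l < m.+3 -> x l = z i y l by move=> lm; rewrite /x cE codeK // zmod.
  have x0 : x 0 = i by rewrite xz // /z m0 w0.
  have zj : z i y j = w i j by rewrite /z jm.
  rewrite /Q' !xz ?zj //; try lia.
  apply/and3P; split.
  - by apply/Qw; rewrite ?x0 // => l lm; rewrite xz /z ?lm //; lia.
  - rewrite /z m0 w0 // ltnn eqxx; have := ltn_ord i; lia.
  - rewrite /z; have [-> -> -> -> ->] : [/\ (m.+1 < m) = false, (m.+1 == m) = false,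
      (m.+2 < m) = false, (m.+2 == m) = false & (m.+2 == m.+1) = false] by split; lia.
    by rewrite eqxx; lia.
Qed.

Ltac ep_step :=
  match goal with
  | |- exp_poly _ (fun v x => x ?i) => apply: exp_poly_var
  | |- exp_poly ?m (fun v x => @?h v) => apply: (@exp_poly_const _ m h)
  | |- exp_poly ?m (fun v x => @?h v ^ x ?i) => apply: (@exp_poly_exp _ m h i)
  | |- exp_poly _ (fun v x => @?f v x + @?g v x) => apply: (@ExpAdd _ _ f g)
  | |- exp_poly _ (fun v x => @?f v x * @?g v x) => apply: (@exp_polyM _ _ f g)
  | |- dioph _ (fun v x => @?f v x == @?g v x) => apply: (@dioph_eq _ _ f g)
  | |- dioph _ (fun v x => @?f v x && @?g v x) => apply: (@dioph_and _ _ f g)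
  end.
Ltac ep_tac := repeat ep_step.

(** This sum is not geometric, so it is obtained by counting: [(i, 2 ^ i, W ^ 2 ^ i)] is the unique
    solution of an exponential system for given [i], and its last coordinate is summed. *)
Lemma arith_sum_pow2 k (W n : k.-tuple nat -> nat) : (forall v, 1 < W v) ->
  arith W -> arith n -> arith (fun v => \sum_(i < (n v).+1) W v ^ 2 ^ i).
Proof.
move=> W1 aW an.
pose Q v (x : nat -> nat) := (x 1 == 2 ^ x 0) && (x 2 == W v ^ x 1).
pose t v := (W v ^ 2 ^ n v).+1.
have dQ : dioph 6 Q.
  by rewrite /Q; ep_tac => //; try exact: arith_const; move=> v; apply: ltnW.
have [||v|f af fE] := @arith_sum_unique k 3 2 Q t (fun v => (n v).+1) isT isT dQ.
- by rewrite /t; arith_tac.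
- by arith_tac.
- by [].
apply: arith_ext af => v.
pose w i l := nth 0 [:: i; 2 ^ i; W v ^ 2 ^ i] l.
have le_pow i : i < (n v).+1 -> W v ^ 2 ^ i <= W v ^ 2 ^ n v.
  by move=> iN; rewrite leq_exp2l ?W1 // leq_exp2l.
rewrite (fE v w); [by apply: eq_bigr | | by [] | |].
- by rewrite /t ltnS ltnW // (ltn_trans (ltn_expl _ (ltnSn 1))) // ltn_expl.
- move=> i [|[|[|//]]] iN _; rewrite /w /t /= ltnS (leq_trans _ (le_pow i iN)) //.
    by rewrite ltnW // (ltn_trans (ltn_expl _ (ltnSn 1))) // ltn_expl.
  by rewrite ltnW // ltn_expl.
move=> x _ _; split; first by move=> /andP[/eqP x1 /eqP x2] [|[|[|//]]] _ //=; rewrite x2 x1.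
by move=> xw; rewrite /Q (xw 1) // (xw 2) // /w /= !eqxx.
Qed.

(* The quotient of (1 + Z) ^ m by Z ^ x is 'C(m, x) modulo the even number Z. *)
Lemma odd_bin_dioph m x K lo s (Z := 2 ^ m.+1) :
  (1 + Z) ^ m = Z ^ x * (2 * K + 1) + lo /\ lo + s + 1 = Z ^ x <->
  [/\ odd 'C(m, x), K = ((1 + Z) ^ m %/ Z ^ x)./2,
      lo = (1 + Z) ^ m %% Z ^ x & s = Z ^ x - 1 - (1 + Z) ^ m %% Z ^ x].
Proof.
have Z0 : 0 < Z ^ x by rewrite !expn_gt0.
have oC : odd 'C(m, x) = odd ((1 + Z) ^ m %/ Z ^ x).
  rewrite bin_closed_form -/Z [in RHS](divn_eq (_ %/ _) Z) oddD oddM.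
  by rewrite [odd Z]oddX andbF.
rewrite oC; set q := _ %/ _; set r := _ %% _.
have e : (1 + Z) ^ m = q * Z ^ x + r := divn_eq _ _.
have rZ : r < Z ^ x by rewrite ltn_mod.
move: q r e rZ Z0 {oC} => q r -> rZ Z0; move: (Z ^ x) rZ Z0 => P rP P0.
split=> [[e1 e2]|[oq -> -> ->]].
  have loP : lo < P by lia.
  have : (q * P + r) %/ P = (P * (2 * K + 1) + lo) %/ P by rewrite e1.
  have : (q * P + r) %% P = (P * (2 * K + 1) + lo) %% P by rewrite e1.
  rewrite [P * _]mulnC !modnMDl !divnMDl // !modn_small // !divn_small // !addn0.
  by move=> -> ->; split; lia.
have -> : 2 * q./2 + 1 = q by lia.
by rewrite mulnC; split; lia.
Qed.

(** * Coding the solutions of a quadratic recurrence *)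

(** By Lucas in blocks of [w] bits, a mask digit [2 ^ u - 1] admits all digits below [2 ^ u],
    whereas a mask digit 0 admits only 0, whence the bound 1. *)
Lemma digits_masked w u N (s : nat -> bool) x : u <= w ->
  odd 'C(\sum_(k < N) s k * (2 ^ u - 1) * (2 ^ w) ^ k, x) <->
  x < (2 ^ w) ^ N /\ forall k, k < N -> digit (2 ^ w) x k < if s k then 2 ^ u else 1.
Proof.
move=> uw; set W := 2 ^ w; set mu := fun k => s k * (2 ^ u - 1).
have W0 : 0 < W by rewrite expn_gt0.
have uW : 2 ^ u <= W by rewrite leq_exp2l.
have muW k : k < N -> mu k < W.
  by move=> _; rewrite /mu; have := expn_gt0 2 u; case: (s k); lia.
have digW k : k < N -> digit W x k < W by move=> _; rewrite /digit ltn_mod.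
have odd_mu k d : odd 'C(mu k, d) = (d < if s k then 2 ^ u else 1).
  rewrite /mu; case: (s k); rewrite ?mul1n ?mul0n; last by case: d.
  apply/idP/idP; last exact: odd_bin_ones.
  by move/odd_bin_leq; have := expn_gt0 2 u; lia.
have core : x < W ^ N -> odd 'C(\sum_(k < N) mu k * W ^ k, x) =
    [forall k : 'I_N, odd 'C(mu k, digit W x k)].
  by move=> xW; rewrite -[in LHS](sum_digits xW) (odd_bin_digits muW digW).
split=> [o|[xW d]].
  have xW : x < W ^ N := leq_ltn_trans (odd_bin_leq o) (sum_digits_lt muW).
  by split=> // k kN; move: o; rewrite core // => /forallP/(_ (Ordinal kN)); rewrite odd_mu.
by rewrite core //; apply/forallP => k; rewrite odd_mu d.
Qed.

Definition masked W N (s : nat -> bool) b x :=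
  x < W ^ N /\ forall k, k < N -> digit W x k < if s k then b else 1.

(** Expresses agreement of two numbers at the places in [s]: [D] is their common part there, [R] and
    [S] are what remains elsewhere. The supports are disjoint, so no carry occurs and all three are
    forced. *)
Lemma split_masked W N s (x y : nat -> nat) D R S :
  (forall k, k < N -> x k < W) -> (forall k, k < N -> y k < W) ->
  [/\ masked W N s W D, masked W N (fun k => ~~ s k) W R, masked W N (fun k => ~~ s k) W S,
      \sum_(k < N) x k * W ^ k = D + R & \sum_(k < N) y k * W ^ k = D + S] <->
  [/\ forall k, k < N -> s k -> x k = y k, D = \sum_(k < N) s k * x k * W ^ k,
      R = \sum_(k < N) ~~ s k * x k * W ^ k & S = \sum_(k < N) ~~ s k * y k * W ^ k].
Proof.
have sumD (d e : nat -> nat) : \sum_(k < N) d k * W ^ k + \sum_(k < N) e k * W ^ k =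
    \sum_(k < N) (d k + e k) * W ^ k.
  by rewrite -big_split; apply: eq_bigr => k _; rewrite mulnDl.
have maskedP (r : nat -> bool) z : (forall k, k < N -> z k < W) ->
    masked W N r W (\sum_(k < N) r k * z k * W ^ k).
  move=> zW; have rz k : k < N -> r k * z k < W.
    by move=> kN; have := zW k kN; case: (r k); lia.
  split=> [|k kN]; first exact: (@sum_digits_lt _ _ (fun k => r k * z k)).
  rewrite (@digit_sum _ _ (fun k => r k * z k)) //.
  by case: (r k) (rz k kN); rewrite ?mul1n ?mul0n.
have splitE D' R' z : (forall k, k < N -> z k < W) ->
    masked W N s W D' -> masked W N (fun k => ~~ s k) W R' ->
    \sum_(k < N) z k * W ^ k = D' + R' ->
    forall k, k < N -> digit W D' k = s k * z k /\ digit W R' k = ~~ s k * z k.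
  move=> zW [DW mD] [RW mR] e.
  have {}e k : k < N -> z k = digit W D' k + digit W R' k.
    apply: (@digits_inj W N z (fun k => digit W D' k + digit W R' k)) => // [l lN|].
      by have := mD l lN; have := mR l lN; have := zW l lN; case: (s l) => /=; lia.
    by rewrite e -(sumD (digit W D') (digit W R')) !sum_digits.
  by move=> k kN; have := mD k kN; have := mR k kN; rewrite e //; case: (s k) => /=; lia.
move=> xW yW; split=> [[mD mR mS eX eY]|[xy -> -> ->]].
  have dX := splitE D R x xW mD mR eX; have dY := splitE D S y yW mD mS eY.
  split.
  - by move=> k kN sk; have := (dX k kN).1; rewrite (dY k kN).1 sk !mul1n.
  - by rewrite -[LHS](sum_digits mD.1); apply: eq_bigr => k _; rewrite (dX k _).1.
  - by rewrite -[LHS](sum_digits mR.1); apply: eq_bigr => k _; rewrite (dX k _).2.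
  - by rewrite -[LHS](sum_digits mS.1); apply: eq_bigr => k _; rewrite (dY k _).2.
split; [exact: maskedP xW | exact: (maskedP (fun k => ~~ s k) x xW)
  | exact: (maskedP (fun k => ~~ s k) y yW) | |].
- rewrite (sumD (fun k => s k * x k) (fun k => ~~ s k * x k)).
  by apply: eq_bigr => k _; rewrite -mulnDl; case: (s k); rewrite mul1n.
- rewrite (sumD (fun k => s k * x k) (fun k => ~~ s k * y k)).
  apply: eq_bigr => k _; case sk: (s k); rewrite /= mul1n ?addn0 //.
  by rewrite xy.
Qed.

(** The place [2 ^ 0] is left out: exponents in a product of two codes are at least 2, and [c 0] is
    prescribed. *)
Definition is_pow2 n k := [exists i : 'I_n, 2 ^ i.+1 == k].

Lemma sum_eq_pow2 n l (f : nat -> nat) :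
  l < n -> \sum_(i < n | 2 ^ i == 2 ^ l) f i = f l.
Proof.
move=> ln; rewrite (eq_bigl (pred1 (Ordinal ln))) ?big_pred1_eq // => i /=.
by rewrite eqn_exp2l.
Qed.

(** This is why the exponents are powers of 2: a mixed product [c i * c j] with [i != j] never
    reaches a place [2 ^ l.+1]. *)
Lemma pow2D_eq i j l : (2 ^ i + 2 ^ j == 2 ^ l.+1) = (i == l) && (j == l).
Proof.
wlog ij : i j / i <= j.
  move=> H; case: (leqP i j) => [|/ltnW]; first exact: H.
  by rewrite addnC andbC; apply: H.
apply/idP/andP => [|[/eqP-> /eqP->]]; last by rewrite expnS mul2n addnn.
move: ij; rewrite leq_eqVlt => /predU1P[->|ij].
  by rewrite addnn -mul2n -expnS eqn_exp2l // eqSS => /eqP->.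
move=> /eqP e; have : 2 ^ j < 2 ^ l.+1 by rewrite -e -[X in X < _]add0n ltn_add2r expn_gt0.
have : 2 ^ l.+1 < 2 ^ j.+1 by rewrite -e expnS mul2n -addnn ltn_add2r ltn_exp2l.
by rewrite !ltn_exp2l //; lia.
Qed.

Lemma sum_is_pow2 n W (g : nat -> nat) : (forall k, ~~ is_pow2 n k -> g k = 0) ->
  \sum_(k < (2 ^ n.+1).+1) g k * W ^ k = \sum_(i < n) g (2 ^ i.+1) * W ^ 2 ^ i.+1.
Proof.
move=> g0; rewrite (@sum_powers _ xpredT (fun i : 'I_n => 2 ^ i.+1) (fun i => g (2 ^ i.+1)) W (2 ^ n.+1).+1).
  apply: eq_bigr => k _; congr (_ * _).
  have [/existsP[i /eqP ki]|nk] := boolP (is_pow2 n k).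
    rewrite (eq_bigl (pred1 i)) ?big_pred1_eq ?ki // => j /=.
    by rewrite -ki eqn_exp2l // eqSS.
  rewrite g0 // big_pred0 // => i; apply: contraNF nk => /eqP ik.
  by apply/existsP; exists i; apply/eqP.
by move=> i _; rewrite ltnS leq_exp2l // ltnW // ltnS.
Qed.

Lemma sum4_ltn a b c d P :
  a < P -> b < P -> c < P -> d < P -> a + b + c + d < 4 * P.
Proof. by lia. Qed.

Lemma sum4_ltn_inv a b c d T :
  a + b + c + d < T -> [/\ a < T, b < T, c < T & d < T].
Proof. by split; lia. Qed.

Lemma slackP y t T : y < T -> (y + t + 1 = T <-> t = T - 1 - y).
Proof. by move=> yT; split; lia. Qed.

Section Code.

Variables (w n : nat).
Let W := 2 ^ w.
Let N := (2 ^ n.+1).+1.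
Let J := \sum_(i < n.+1) W ^ 2 ^ i.

Definition code_of (c : nat -> nat) := \sum_(i < n.+1) c i * W ^ 2 ^ i.

(** [coef1] and [coef2] are the coefficients of [W ^ k], before any carry, in a code and in a
    product of two codes. *)
Definition coef1 (c : nat -> nat) k := \sum_(i < n.+1 | 2 ^ i == k) c i.
Definition coef2 (c : nat -> nat -> nat) k :=
  \sum_(p : 'I_n.+1 * 'I_n.+1 | 2 ^ p.1 + 2 ^ p.2 == k) c p.1 p.2.

Lemma code_digits c : code_of c = \sum_(k < N) coef1 c k * W ^ k.
Proof.
rewrite /code_of (@sum_powers _ xpredT (fun i : 'I_n.+1 => 2 ^ i) (fun i => c i) W N) //.
by move=> i _; rewrite /N ltnS leq_exp2l // ltnW.
Qed.

Lemma code_mul_digits c d :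
  code_of c * code_of d = \sum_(k < N) coef2 (fun i j => c i * d j) k * W ^ k.
Proof.
rewrite /code_of big_distrl /=.
under eq_bigr => i _ do rewrite big_distrr /=.
rewrite pair_big /=.
rewrite (eq_bigr (fun p : 'I_n.+1 * 'I_n.+1 => c p.1 * d p.2 * W ^ (2 ^ p.1 + 2 ^ p.2))).
  rewrite (@sum_powers _ xpredT (fun p : 'I_n.+1 * 'I_n.+1 => 2 ^ p.1 + 2 ^ p.2)
    (fun p => c p.1 * d p.2) W N) // => p _.
  by rewrite /N ltnS expnS mul2n -addnn leq_add // leq_exp2l // -ltnS.
by move=> p _; rewrite expnD mulnACA.
Qed.

Lemma coef1_pow2 c l : l < n.+1 -> coef1 c (2 ^ l) = c l.
Proof. exact: sum_eq_pow2. Qed.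

Lemma coef2_pow2 c l : l < n -> coef2 c (2 ^ l.+1) = c l l.
Proof.
move=> ln; have ln' := leqW ln.
rewrite /coef2 (eq_bigl (pred1 (Ordinal ln', Ordinal ln'))) ?big_pred1_eq // => -[i j] /=.
by rewrite pow2D_eq xpair_eqE.
Qed.

Lemma coef1_leq c b k : (forall i, i < n.+1 -> c i <= b) -> coef1 c k <= n.+1 * b.
Proof.
move=> cb; rewrite /coef1 big_mkcond /= -[X in X * _]card_ord -sum_nat_const.
by apply: leq_sum => i _; case: eqP => // _; apply: cb.
Qed.

Lemma coef2_leq c b k : (forall i j, i < n.+1 -> j < n.+1 -> c i j <= b) ->
  coef2 c k <= n.+1 ^ 2 * b.
Proof.
move=> cb; rewrite /coef2 big_mkcond /= -mulnn -[X in X * X]card_ord -card_prod -sum_nat_const.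
by apply: leq_sum => i _; case: eqP => // _; apply: cb.
Qed.

(* The digits of a * C + p * C ^ 2 and of e * C * J in base W at the places
   2 ^ 1, ..., 2 ^ n are a * c (i + 1) + p * c i ^ 2 and e * c i. *)
Variables a p e u : nat.
Hypothesis uw : u <= w.
Hypothesis W_large :
  a * (n.+1 * 2 ^ u) + p * (n.+1 ^ 2 * (2 ^ u * 2 ^ u)) + e * (n.+1 ^ 2 * 2 ^ u) < W.

Definition lhs_digit c k := a * coef1 c k + p * coef2 (fun i j => c i * c j) k.
Definition rhs_digit c k := e * coef2 (fun i j => c i * 1) k.

Lemma lhs_digits c :
  a * code_of c + p * code_of c ^ 2 = \sum_(k < N) lhs_digit c k * W ^ k.
Proof.
rewrite -mulnn code_mul_digits code_digits !big_distrr -big_split /=.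
by apply: eq_bigr => k _; rewrite !mulnA -mulnDl.
Qed.

Lemma rhs_digits c : e * code_of c * J = \sum_(k < N) rhs_digit c k * W ^ k.
Proof.
have -> : J = code_of (fun=> 1) by apply: eq_bigr => i _; rewrite mul1n.
rewrite -mulnA code_mul_digits big_distrr.
by apply: eq_bigr => k _; rewrite /= mulnA.
Qed.

(** [coef1] has at most [n.+1] terms and [coef2] at most [n.+1 ^ 2], so [W_large] rules out carries:
    the coefficients are the true base [W] digits. *)
Lemma lhs_digit_lt c k : (forall i, i < n.+1 -> c i < 2 ^ u) -> lhs_digit c k < W.
Proof.
move=> cu; apply: leq_ltn_trans W_large; apply: leq_trans (leq_addr _ _).
apply: leq_add; rewrite leq_mul2l; apply/orP; right.
  by apply: coef1_leq => i iN; apply: ltnW (cu i iN).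
by apply: coef2_leq => i j iN jN; apply: leq_mul; apply: ltnW; apply: cu.
Qed.

Lemma rhs_digit_lt c k : (forall i, i < n.+1 -> c i < 2 ^ u) -> rhs_digit c k < W.
Proof.
move=> cu; apply: leq_ltn_trans W_large; apply: leq_trans (leq_addl _ _).
rewrite leq_mul2l; apply/orP; right.
by apply: coef2_leq => i j iN jN; rewrite muln1; apply: ltnW (cu i iN).
Qed.

Variable c : nat -> nat.
Hypothesis a0 : 0 < a.
Hypothesis c_lt : forall i, i < n.+1 -> c i < 2 ^ u.
Hypothesis c_rec : forall i, i < n -> a * c i.+1 + p * c i ^ 2 = e * c i.

Let s := is_pow2 n.

Definition tail_code := \sum_(i < n) c i.+1 * W ^ 2 ^ i.+1.
Definition D_code := \sum_(k < N) s k * lhs_digit c k * W ^ k.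
Definition R_code := \sum_(k < N) ~~ s k * lhs_digit c k * W ^ k.
Definition S_code := \sum_(k < N) ~~ s k * rhs_digit c k * W ^ k.

(** Only the tail [E] of the code is unknown, its first term [c 0 * W] being given. The masks on [E]
    make [C] the code of some sequence, and the two equations force on it the recurrence. *)
Lemma code_unique E D R S (C := c 0 * W + E) :
  [/\ masked W N s (2 ^ u) E,
     [/\ masked W N s W D, masked W N (fun k => ~~ s k) W R & masked W N (fun k => ~~ s k) W S],
      a * C + p * C ^ 2 = D + R & e * C * J = D + S] <->
  [/\ E = tail_code, D = D_code, R = R_code & S = S_code].
Proof.
have code_cons d : code_of d = d 0 * W + \sum_(i < n) d i.+1 * W ^ 2 ^ i.+1.
  by rewrite /code_of big_ord_recl.
have rec_digit d l : l < n -> (lhs_digit d (2 ^ l.+1) == rhs_digit d (2 ^ l.+1)) =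
    (a * d l.+1 + p * d l ^ 2 == e * d l).
  by move=> ln; rewrite /lhs_digit /rhs_digit coef1_pow2 // !coef2_pow2 // muln1 mulnn.
have cd k : k < N -> s k -> lhs_digit c k = rhs_digit c k.
  by move=> _ /existsP[i /eqP<-]; apply/eqP; rewrite rec_digit // c_rec.
have lc k (_ : k < N) := lhs_digit_lt k c_lt; have rc k (_ : k < N) := rhs_digit_lt k c_lt.
split=> [[[EW mE] [mD mR mS] eX eY]|[Ec Dc Rc Sc]]; last first.
  have Cc : C = code_of c by rewrite code_cons /C Ec.
  have [_ /(_ (And4 cd Dc Rc Sc)) [mD mR mS eX eY]] := split_masked s D R S lc rc.
  split; [|by split|by rewrite Cc lhs_digits|by rewrite Cc rhs_digits].
  pose g k := if s k then coef1 c k else 0.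
  have uW : 2 ^ u <= W by rewrite leq_exp2l.
  have gu k : k < N -> g k < if s k then 2 ^ u else 1.
    rewrite /g => _; case sk: (s k) => //; move/existsP: sk => [i /eqP<-].
    by rewrite coef1_pow2 ?ltnS // c_lt // ltnS.
  have gW k : k < N -> g k < W.
    move=> kN; have := gu k kN; have : 0 < W by rewrite expn_gt0.
    by case: (s k); lia.
  have Eg : E = \sum_(k < N) g k * W ^ k.
    rewrite sum_is_pow2 => [|k]; last by rewrite /g => /negPf; rewrite -/s => ->.
    rewrite Ec; apply: eq_bigr => i _; congr (_ * _); rewrite /g.
    have -> : s (2 ^ i.+1) by apply/existsP; exists i.
    by rewrite coef1_pow2 // ltnS.
  split=> [|k kN]; first by rewrite Eg sum_digits_lt.
  by rewrite Eg digit_sum // gu.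
(* The candidate sequence is read off the digits of [E], with the prescribed initial value. *)
pose d i := if i is j.+1 then digit W E (2 ^ j.+1) else c 0.
have d_lt i : i < n.+1 -> d i < 2 ^ u.
  case: i => [|i] iN; first exact: c_lt.
  have iN' : 2 ^ i.+1 < N by rewrite /N ltnS leq_exp2l // ltnW.
  have := mE _ iN'; have -> // : s (2 ^ i.+1).
  by apply/existsP; exists (Ordinal (iN : i < n)).
have Ed : E = \sum_(i < n) d i.+1 * W ^ 2 ^ i.+1.
  pose g k := if s k then digit W E k else 0.
  rewrite -[LHS](sum_digits EW) (eq_bigr (fun k : 'I_N => g k * W ^ k)) => [|k _].
    rewrite sum_is_pow2 => [|k]; last by rewrite /g => /negPf; rewrite -/s => ->.
    apply: eq_bigr => i _; rewrite /g; have -> // : s (2 ^ i.+1).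
    by apply/existsP; exists i.
  rewrite /g; congr (_ * _); have := mE k (ltn_ord k); case: (s k) => //.
  by case: (digit W E k).
have Cd : C = code_of d by rewrite code_cons /C {1}Ed.
rewrite Cd lhs_digits in eX; rewrite Cd rhs_digits in eY.
have ld k (_ : k < N) := lhs_digit_lt k d_lt; have rd k (_ : k < N) := rhs_digit_lt k d_lt.
have [/(_ (And5 mD mR mS eX eY)) [xy Dd Rd Sd] _] := split_masked s D R S ld rd.
(* Agreement at the place [2 ^ i.+1] is the recurrence for [d]; as [a > 0], it determines [d i.+1]
   from [d i]. *)
have dc i : i < n.+1 -> d i = c i.
  elim: i => [|i IH] iN //; have iN' : i < n by [].
  have kN : 2 ^ i.+1 < N by rewrite /N ltnS leq_exp2l // ltnW.
  have sk : s (2 ^ i.+1) by apply/existsP; exists (Ordinal iN').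
  have := rec_digit d i iN'; rewrite xy // eqxx IH ?(leqW iN') // -c_rec //.
  by rewrite eqn_add2r eqn_pmul2l // => /esym/eqP.
have coef1E k : coef1 d k = coef1 c k by apply: eq_bigr => i _; rewrite dc.
have lE k : lhs_digit d k = lhs_digit c k.
  by rewrite /lhs_digit coef1E; congr (_ + _ * _); apply: eq_bigr => q _; rewrite !dc.
have rE k : rhs_digit d k = rhs_digit c k.
  by rewrite /rhs_digit; congr (_ * _); apply: eq_bigr => q _; rewrite !dc.
split.
- by rewrite Ed; apply: eq_bigr => i _; rewrite dc // ltnS.
- by rewrite Dd; apply: eq_bigr => k _; rewrite lE.
- by rewrite Rd; apply: eq_bigr => k _; rewrite lE.
- by rewrite Sd; apply: eq_bigr => k _; rewrite rE.
Qed.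

(** * Merging the four digit conditions into one binomial coefficient *)

Definition pow2_places := J - W.
(** This is [4 * W ^ N]: the factor 4 leaves room for the sum of four numbers below [W ^ N], so that
    a single slack variable bounds all of them. *)
Definition tau := 2 ^ (w * N + 2).
(** Four blocks in base [tau], from the top the masks of [S], [R], [D] and [E]. Subtracting from
    [W ^ N - 1], all of whose digits are [W - 1], gives the mask of the complementary places. *)
Definition full_mask :=
  ((W ^ N - 1 - (W - 1) * pow2_places) * tau + (W ^ N - 1 - (W - 1) * pow2_places)) * (tau * tau)
  + (W - 1) * pow2_places * tau + (2 ^ u - 1) * pow2_places.
Definition full_code E D R S := E + tau * D + tau ^ 2 * R + tau ^ 3 * S.

(** Splits the power into factors with a single unknown in each exponent, the shape that [exp_poly]
    allows. *)
Lemma exp_full_code z E D R S :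
  z ^ full_code E D R S = z ^ E * (z ^ tau) ^ D * (z ^ tau ^ 2) ^ R * (z ^ tau ^ 3) ^ S.
Proof. by rewrite /full_code; move: tau => T; rewrite -!expnM -!expnD. Qed.

Lemma pow2_places_digits b : b * pow2_places = \sum_(k < N) s k * b * W ^ k.
Proof.
rewrite (@sum_is_pow2 n W (fun k => s k * b)) => [|k /negPf]; last by rewrite /s => ->.
rewrite /pow2_places /J big_ord_recl addKn big_distrr.
apply: eq_bigr => i _; congr (_ * _).
by have -> : s (2 ^ i.+1) by [apply/existsP; exists i]; rewrite mul1n.
Qed.

Lemma other_places_digits :
  W ^ N - 1 - (W - 1) * pow2_places = \sum_(k < N) ~~ s k * (W - 1) * W ^ k.
Proof.
rewrite subn1 predn_exp -subn1 big_distrr /= pow2_places_digits.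
have -> : \sum_(i < N) (W - 1) * W ^ i =
    \sum_(k < N) ~~ s k * (W - 1) * W ^ k + \sum_(k < N) s k * (W - 1) * W ^ k.
  by rewrite -big_split; apply: eq_bigr => k _ /=; case: (s k); rewrite !mul1n ?addn0.
by rewrite addnK.
Qed.

Lemma tauE : tau = 4 * W ^ N. Proof. by rewrite /tau expnD expnM mulnC. Qed.

Lemma masked_full_code E D R S : E < tau -> D < tau -> R < tau -> S < tau ->
  odd 'C(full_mask, full_code E D R S) <->
  masked W N s (2 ^ u) E /\
  [/\ masked W N s W D, masked W N (fun k => ~~ s k) W R & masked W N (fun k => ~~ s k) W S].
Proof.
move=> Et Dt Rt St; rewrite /full_mask.
have -> : full_code E D R S = ((S * tau + R) * tau + D) * tau + E.
  by rewrite /full_code !expnS expn0; ring.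
have -> : forall x y z, (x * tau + x) * (tau * tau) + y * tau + z =
    ((x * tau + x) * tau + y) * tau + z by move=> x y z; ring.
have mask_lt b (r : nat -> bool) : b <= W - 1 -> \sum_(k < N) r k * b * W ^ k < tau.
  move=> bW; apply: (@leq_trans (W ^ N)); last by rewrite tauE leq_pmull.
  apply: (@sum_digits_lt _ _ (fun k => r k * b)) => k _.
  by have := expn_gt0 2 w; rewrite -/W; case: (r k); lia.
have uW : 2 ^ u - 1 <= W - 1 by rewrite leq_sub2r // leq_exp2l.
have mE := mask_lt _ s uW; have mD := mask_lt _ s (leqnn _).
have mO := mask_lt _ (fun k => ~~ s k) (leqnn _).
rewrite other_places_digits !pow2_places_digits.
rewrite !odd_bin_block //.
have dm (r : nat -> bool) b x : b <= w -> odd 'C(\sum_(k < N) r k * (2 ^ b - 1) * W ^ k, x) <->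
    masked W N r (2 ^ b) x by apply: digits_masked.
split=> [/andP[/andP[/andP[oS oR] oD] oE]|[oE [oD oR oS]]].
  split; first exact/dm.
  by split; [apply/(dm s w) | apply/(dm (fun k => ~~ s k) w) | apply/(dm (fun k => ~~ s k) w)].
apply/andP; split; last exact/dm.
apply/andP; split; last exact/(dm s w).
by apply/andP; split; apply/(dm (fun k => ~~ s k) w).
Qed.

Let Z := 2 ^ full_mask.+1.
Let x := full_code tail_code D_code R_code S_code.

(** The slack [t] bounds [E], [D], [R], [S] by [tau], so they are separate blocks of the exponent.
    Then [odd_bin_dioph] gives the masks and fixes [K], [lo], [r], and [code_unique] fixes the
    rest. *)
Lemma system_unique E D R S t K lo r (C := c 0 * W + E)
    (P := Z ^ E * (Z ^ tau) ^ D * (Z ^ tau ^ 2) ^ R * (Z ^ tau ^ 3) ^ S) :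
  [/\ a * C + p * C ^ 2 = D + R, e * C * J = D + S, E + D + R + S + t + 1 = tau &
     (1 + Z) ^ full_mask = P * (2 * K + 1) + lo /\ lo + r + 1 = P] <->
  [/\ [/\ E = tail_code, D = D_code, R = R_code & S = S_code],
     t = tau - 1 - (tail_code + D_code + R_code + S_code) &
     [/\ K = ((1 + Z) ^ full_mask %/ Z ^ x)./2, lo = (1 + Z) ^ full_mask %% Z ^ x &
        r = Z ^ x - 1 - (1 + Z) ^ full_mask %% Z ^ x]].
Proof.
have -> : P = Z ^ full_code E D R S by rewrite exp_full_code.
rewrite {P}/C {C}.
have [mE [mD mR mS] eX eY] :=
  (code_unique tail_code D_code R_code S_code).2 (And4 erefl erefl erefl erefl).
have lt4 : tail_code + D_code + R_code + S_code < tau.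
  by rewrite tauE; apply: sum4_ltn; [exact: mE.1 | exact: mD.1 | exact: mR.1 | exact: mS.1].
have o : odd 'C(full_mask, x).
  by have [? ? ? ?] := sum4_ltn_inv lt4; apply/masked_full_code.
split=> [[e1 e2 e3 /odd_bin_dioph[o' Kc lc rc]]|[[-> -> -> ->] -> [Kc lc rc]]]; last first.
  split=> //; last by apply/odd_bin_dioph.
  exact/slackP.
have lt4' : E + D + R + S < tau by rewrite -e3 addn1 ltnS leq_addr.
have [Et Dt Rt St] := sum4_ltn_inv lt4'.
have [mE' m'] := (masked_full_code Et Dt Rt St).1 o'.
have [Ec Dc Rc Sc] := (code_unique E D R S).1 (And4 mE' m' e1 e2).
rewrite Kc lc rc /x -Ec -Dc -Rc -Sc; split=> //.
exact/slackP.
Qed.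

End Code.

(** * The logistic map *)

Lemma logistic_den_gt0 b q n : 0 < b -> 0 < q -> 0 < logistic_den b q n.
Proof. by move=> b0 q0; elim: n => //= n IH; rewrite muln_gt0 q0 expn_gt0 IH. Qed.

Lemma logistic_den_closed b q n : logistic_den b q n = q ^ (2 ^ n - 1) * b ^ 2 ^ n.
Proof.
elim: n => [|n IH]; first by rewrite mul1n.
rewrite /= IH expnMn -!expnM mulnA -expnS [2 ^ n.+1]expnS.
by congr (q ^ _ * b ^ _); have := expn_gt0 2 n; lia.
Qed.

Lemma logistic_num_leq a b p q n : a <= b -> p <= 4 * q ->
  logistic_num a b p q n <= logistic_den b q n.
Proof.
move=> ab pq; elim: n => //= n; move: (logistic_num _ _ _ _ _) (logistic_den _ _ _) => x y xy.
rewrite -mulnA; apply: (@leq_trans (4 * q * (x * (y - x)))); first by rewrite leq_mul2r pq orbT.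
rewrite -mulnA mulnCA leq_mul2l; apply/orP; right.
have /(f_equal (fun z => z ^ 2)) : x + (y - x) = y by rewrite subnKC.
by move: (y - x) => z <-; have [] := nat_AGM2 x z.
Qed.

Lemma dvdn_logistic_den b q i n : i <= n -> logistic_den b q i %| logistic_den b q n.
Proof.
elim: n => [|n IH]; first by case: i.
rewrite leq_eqVlt => /predU1P[->//|/IH d]; apply: dvdn_trans d _.
by rewrite /= -mulnn dvdn_mull // dvdn_mull.
Qed.

(* The numerators over the common denominator b(n): their recurrence has constant
   coefficients. *)
Definition scaled_num a b p q n i :=
  logistic_num a b p q i * (logistic_den b q n %/ logistic_den b q i).

Lemma scaled_num_rec a b p q n i (B := logistic_den b q n) :
  0 < b -> 0 < q -> a <= b -> p <= 4 * q -> i < n ->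
  q * B * scaled_num a b p q n i.+1 + p * scaled_num a b p q n i ^ 2 =
    p * B * scaled_num a b p q n i.
Proof.
move=> b0 q0 ab pq iltn; have := dvdn_logistic_den b q iltn.
have := logistic_num_leq i ab pq; have := logistic_den_gt0 i b0 q0.
rewrite /scaled_num -/B /= => d0 xd /dvdnP[h ->]; move: d0 xd.
move: (logistic_num _ _ _ _ _) (logistic_den _ _ _) => x y y0 xy.
rewrite mulnK ?muln_gt0 ?q0 ?expn_gt0 ?y0 //.
(* With [h] the quotient of [b(n)] by [b(i+1)], the scaled numerators at [i] and [i + 1] are
   [x * (h * q * y)] and [p * x * (y - x) * h]. *)
have -> : h * (q * y ^ 2) %/ y = h * q * y by rewrite -mulnn !mulnA mulnK.
have e : y - x + x = y by rewrite subnK.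
by move: (y - x) e => z <-; ring.
Qed.

Lemma scaled_num_leq a b p q n i : 0 < b -> 0 < q -> a <= b -> p <= 4 * q -> i <= n ->
  scaled_num a b p q n i <= logistic_den b q n.
Proof.
move=> b0 q0 ab pq iltn; rewrite -(divnK (dvdn_logistic_den b q iltn)) mulnC.
by rewrite /scaled_num leq_mul2r logistic_num_leq ?orbT.
Qed.

Lemma logistic_ratio a b p q n : 0 < b -> 0 < q -> a <= b -> p <= 4 * q ->
  logistic (p%:R / q%:R)%R (a%:R / b%:R)%R n =
    ((logistic_num a b p q n)%:R / (logistic_den b q n)%:R)%R.
Proof.
move=> b0 q0 ab pq; elim: n => //= n ->.
have := logistic_num_leq n ab pq; have := logistic_den_gt0 n b0 q0.
move: (logistic_num _ _ _ _ _) (logistic_den _ _ _) => x y y0 xy.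
rewrite !GRing.natrM GRing.natrB // ?GRing.natrX.
have qn0 : (q%:R != 0 :> rat)%R by rewrite Num.Theory.pnatr_eq0 -lt0n.
have yn0 : (y%:R != 0 :> rat)%R by rewrite Num.Theory.pnatr_eq0 -lt0n.
by field; rewrite qn0 yn0.
Qed.

Lemma arith_logistic_num : exists2 f : 5.-tuple nat -> nat, arith f &
  forall a b p q n, 0 < b -> 0 < q -> a <= b -> p <= 4 * q ->
    f [tuple a; b; p; q; n] = logistic_num a b p q n.
Proof.
pose va (v : 5.-tuple nat) := tnth v (@Ordinal 5 0 isT).
pose vb (v : 5.-tuple nat) := tnth v (@Ordinal 5 1 isT).
pose vp (v : 5.-tuple nat) := tnth v (@Ordinal 5 2 isT).
pose vq (v : 5.-tuple nat) := tnth v (@Ordinal 5 3 isT).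
pose vn (v : 5.-tuple nat) := tnth v (@Ordinal 5 4 isT).
have ha : arith va := arith_var _. have hb : arith vb := arith_var _.
have hp : arith vp := arith_var _. have hq : arith vq := arith_var _.
have hn : arith vn := arith_var _.
pose B v := vq v ^ (2 ^ vn v - 1) * vb v ^ 2 ^ vn v.
have hB : arith B by rewrite /B; arith_tac.
pose c0 v := va v * (B v %/ vb v).
have hc0 : arith c0 by rewrite /c0; arith_tac.
(* The first three summands are the bound in [W_large] for [u = B v], and [2 ^ w v] exceeds [w v].
   The summand [B v] ensures [u <= w], and 1 ensures [W > 1]. The numerators are at most
   [B v < 2 ^ B v]. *)
pose w v := vq v * B v * ((vn v).+1 * 2 ^ B v)
  + vp v * ((vn v).+1 ^ 2 * (2 ^ B v * 2 ^ B v))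
  + vp v * B v * ((vn v).+1 ^ 2 * 2 ^ B v) + B v + 1.
have hw : arith w by rewrite /w; arith_tac.
pose W v := 2 ^ w v.
have hW : arith W by rewrite /W; arith_tac.
have W1 v : 1 < W v by rewrite /W -[1]/(2 ^ 0) ltn_exp2l // /w addn1.
pose J v := \sum_(i < (vn v).+1) W v ^ 2 ^ i.
have hJ : arith J := arith_sum_pow2 W1 hW hn.
pose N v := (2 ^ (vn v).+1).+1.
have hN : arith N by rewrite /N; arith_tac.
pose T v := 2 ^ (w v * N v + 2).
have hT : arith T by rewrite /T; arith_tac.
pose M v :=
  ((W v ^ N v - 1 - (W v - 1) * (J v - W v)) * T v + (W v ^ N v - 1 - (W v - 1) * (J v - W v)))
    * (T v * T v) + (W v - 1) * (J v - W v) * T v + (2 ^ B v - 1) * (J v - W v).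
have hM : arith M by rewrite /M; arith_tac.
pose Z v := 2 ^ (M v).+1.
have hZ : arith Z by rewrite /Z; arith_tac.
have Z0 v : 0 < Z v by rewrite expn_gt0.
pose P v (x : nat -> nat) :=
  Z v ^ x 1 * (Z v ^ T v) ^ x 2 * (Z v ^ T v ^ 2) ^ x 3 * (Z v ^ T v ^ 3) ^ x 4.
pose C v (x : nat -> nat) := c0 v * W v + x 1.
pose Q v (x : nat -> nat) :=
  (vq v * B v * C v x + vp v * (C v x * C v x) == x 2 + x 3) &&
  ((vp v * B v * C v x * J v == x 2 + x 4) &&
  ((x 1 + x 2 + x 3 + x 4 + x 5 + 1 == T v) &&
  (((1 + Z v) ^ M v == P v x * (2 * x 6 + 1) + x 7) && (x 7 + x 8 + 1 == P v x)))).
have dQ : dioph 12 Q.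
  rewrite /Q /P /C; ep_tac => //; try (by arith_tac); try (by move=> v; rewrite expn_gt0 Z0).
(* The unknowns [x 1] to [x 5] are below [T v], and [x 6] to [x 8] are at most [(1 + Z v) ^ M v]. *)
pose t v := T v + (1 + Z v) ^ M v + 1.
have ht : arith t by rewrite /t; arith_tac.
have t0 v : 0 < t v by rewrite /t addn1.
(* A sum over the single index 0 simply extracts the coordinate [E] of the unique solution. *)
have [f hf fE] := @arith_sum_unique 5 9 1 Q t (fun=> 1) isT isT dQ ht (arith_const 5 1) t0.
(* The digit of the code at the place [2 ^ n] is the last scaled numerator, which is [a(n)] itself
   because its scaling factor is 1. *)
exists (fun v => (c0 v * W v + f v) %/ W v ^ 2 ^ vn v %% W v); first by arith_tac.
move=> a b p q n b0 q0 ab pq; set v := [tuple a; b; p; q; n].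
have BE : B v = logistic_den b q n by rewrite logistic_den_closed.
pose c := scaled_num a b p q n.
have c0E : c0 v = c 0 by rewrite /c0 BE.
have cB i : i < n.+1 -> c i < 2 ^ B v.
  by move=> iN; rewrite (leq_ltn_trans _ (ltn_expl _ (ltnSn 1))) // BE scaled_num_leq.
have uw : B v <= w v by rewrite /w -addnA addnCA leq_addr.
have W_large : q * B v * (n.+1 * 2 ^ B v) + p * (n.+1 ^ 2 * (2 ^ B v * 2 ^ B v))
    + p * B v * (n.+1 ^ 2 * 2 ^ B v) < 2 ^ w v.
  by rewrite (leq_ltn_trans _ (ltn_expl _ (ltnSn 1))) // /w -!addnA !leq_add2l leq_addr.
have qB0 : 0 < q * B v by rewrite BE muln_gt0 q0 logistic_den_gt0.
have c_rec i : i < n -> q * B v * c i.+1 + p * c i ^ 2 = p * B v * c i.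
  by move=> iltn; rewrite BE; apply: scaled_num_rec.
have sysE := system_unique uw W_large qB0 cB c_rec.
have ME : M v = full_mask (w v) n (B v) by [].
have JE : J v = \sum_(i < n.+1) (2 ^ w v) ^ 2 ^ i by [].
have TE : T v = tau (w v) n by [].
rewrite -JE -TE -ME -/(Z v) -/(W v) in sysE.
set E0 := tail_code (w v) n c in sysE.
set D0 := D_code (w v) n (q * B v) p c in sysE.
set R0 := R_code (w v) n (q * B v) p c in sysE.
set S0 := S_code (w v) n (p * B v) c in sysE.
set z := full_code (w v) n E0 D0 R0 S0 in sysE.
set t1 := T v - 1 - _ in sysE.
set K1 := _./2 in sysE.
set lo1 := (1 + Z v) ^ M v %% Z v ^ z in sysE.
set r1 := Z v ^ z - 1 - lo1 in sysE.
pose sol i l := nth 0 [:: i; E0; D0; R0; S0; t1; K1; lo1; r1] l.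
have QE x : Q v x <-> [/\ [/\ x 1 = E0, x 2 = D0, x 3 = R0 & x 4 = S0], x 5 = t1 &
    [/\ x 6 = K1, x 7 = lo1 & x 8 = r1]].
  rewrite -sysE -c0E; split.
    by move=> /and5P[/eqP e1 /eqP e2 /eqP e3 /eqP e4 /eqP e5]; rewrite -mulnn.
  move=> [e1 e2 e3 [e4 e5]]; rewrite -mulnn in e1.
  by apply/and5P; split; apply/eqP.
have sol_lt l : l < 9 -> sol 0 l < t v.
  have /QE : [/\ [/\ sol 0 1 = E0, sol 0 2 = D0, sol 0 3 = R0 & sol 0 4 = S0],
    sol 0 5 = t1 & [/\ sol 0 6 = K1, sol 0 7 = lo1 & sol 0 8 = r1]] by [].
  rewrite /Q; have : 0 < P v (sol 0) by rewrite /P !muln_gt0 !expn_gt0 ?Z0.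
  move: (P v (sol 0)) => y y0 /and5P[_ _ /eqP e3 /eqP e4 /eqP e5].
  have sub_t : T v <= t v /\ (1 + Z v) ^ M v < t v by rewrite /t; split; lia.
  move: e3 e4 sub_t; move: (T v) ((1 + Z v) ^ M v) (t v) (t0 v) => T1 Z1 tv tv0 e3 e4 [Tt Zt].
  have yZ : y <= Z1 by rewrite e4 mulnDr muln1 -addnA addnCA leq_addr.
  have KZ : sol 0 6 <= Z1 by rewrite e4; apply: leq_trans (leq_addr _ _); nia.
  by move: l => [|[|[|[|[|[|[|[|[|//]]]]]]]]] _ //; lia.
have fvE : f v = E0.
  rewrite (fE v sol); first by rewrite big_ord1.
  - exact: t0.
  - by [].
  - by move=> [|//] l _; apply: sol_lt.
  - move=> x x0 _; rewrite QE; split.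
      move=> [[e1 e2 e3 e4] e5 [e6 e7 e8]].
      by case=> [|[|[|[|[|[|[|[|[|//]]]]]]]]] _ //=.
    by move=> xs; split; [split | | split]; apply: xs.
have -> : c0 v * W v + f v = code_of (w v) n c by rewrite fvE c0E /code_of big_ord_recl.
rewrite code_digits -/(digit (W v) _ _) digit_sum.
- rewrite coef1_pow2 // /c /scaled_num divnn logistic_den_gt0 // muln1 //.
- move=> k _; apply: leq_ltn_trans (lhs_digit_lt W_large k cB).
  by rewrite /lhs_digit; apply: leq_trans (leq_addr _ _); rewrite leq_pmull.
- by rewrite ltnS leq_exp2l.
Qed.

Theorem mainTheorem6 :
  exists M : aterm 5,
  forall a b p q : nat,
    1 <= b -> 1 <= q -> a <= b -> p <= 4 * q ->
  forall n : nat,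
    [/\ logistic_den b q n = q ^ (2 ^ n - 1) * b ^ (2 ^ n),
        logistic_num a b p q n =
          aeval M [tuple a; b; p; q; n]
            %/ (q ^ (2 ^ n - 1) * b ^ (2 ^ n) + 1) ^ n
      & logistic (p%:R / q%:R)%R (a%:R / b%:R)%R n =
          ((logistic_num a b p q n)%:R / (logistic_den b q n)%:R)%R].
Proof.
have [f [t tf] fE] := arith_logistic_num.
have vb : arith (fun v : 5.-tuple nat => tnth v (@Ordinal 5 1 isT)) := arith_var _.
have vq : arith (fun v : 5.-tuple nat => tnth v (@Ordinal 5 3 isT)) := arith_var _.
have vn : arith (fun v : 5.-tuple nat => tnth v (@Ordinal 5 4 isT)) := arith_var _.
have [d dE] : arith (fun v : 5.-tuple nat =>
    (tnth v (@Ordinal 5 3 isT) ^ (2 ^ tnth v (@Ordinal 5 4 isT) - 1) *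
     tnth v (@Ordinal 5 1 isT) ^ 2 ^ tnth v (@Ordinal 5 4 isT) + 1)
      ^ tnth v (@Ordinal 5 4 isT)) by arith_tac.
(* [M] is the term for [a(n)] times the positive divisor, so the division is exact. *)
exists (aMul t d) => a b p q b0 q0 ab pq n; split.
- exact: logistic_den_closed.
- by rewrite /= tf dE fE // mulnK // expn_gt0 addn1.
- exact: logistic_ratio.
Qed.
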